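(* Fix an integer $d\ge 2$ and $\lambda>0$. If the hard sphere model on $\mathbb{R}^d$ at fugacity $\lambda$ exhibits strong spatial mixing, then there is an $L_0>0$ such that for every $L\ge L_0$ the heat-bath dynamics with update radius $L$ exhibits optimal temporal mixing on $\mathbb{R}^d$ at fugacity $\lambda$.
   Context: Let $r=r_d>0$ be the radius for which a ball of radius $r$ in $\mathbb{R}^d$ has volume $1$; $B_\ell(x)$ is the open ball of radius $\ell$ about $x$, $|A|$ is Lebesgue measure, and $A^{(\ell)}=\{x\in\mathbb{R}^d:\mathrm{dist}(x,A)\le\ell\}$. For compact measurable $\Lambda\subset\mathbb{R}^d$ let $\Lambda_{\mathrm{Int}}=\{x\in\Lambda:\mathrm{dist}(x,\Lambda^c)\ge r\}$. A boundary condition is a (measurable) set $\tau\subseteq\Lambda_{\mathrm{Int}}$ of forbidden locations for centers. $\Omega_\Lambda$ is the set of all finite point sets in $\Lambda_{\mathrm{Int}}$ with pairwise distances at least $2r$, and $\Omega_\Lambda^\tau\subseteq\Omega_\Lambda$ is the set of those contained in $\Lambda_{\mathrm{Int}}\setminus\tau$. The hard sphere model $\mu_\Lambda^\tau$ at fugacity $\lambda$ with boundary condition $\tau$ is the law of a Poisson point process of intensity $\lambda$ on $\Lambda_{\mathrm{Int}}\setminus\tau$ conditioned on all points being at pairwise distance at least $2r$. For $\Lambda'\subseteq\Lambda$ and probability measures $\mu_1,\mu_2$ on $\Omega_\Lambda$, $\|\mu_1-\mu_2\|_{\Lambda'}$ is the total variation distance between the pushforwards of $\mu_1,\mu_2$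 to $\Omega_{\Lambda'}$ under the projection $X\mapsto X\cap\Lambda'_{\mathrm{Int}}$. Strong spatial mixing (SSM): the hard sphere model at fugacity $\lambda$ exhibits strong spatial mixing on $\mathbb{R}^d$ if there exist $\alpha,\beta>0$ such that for all compact measurable $\Lambda'\subseteq\Lambda\subset\mathbb{R}^d$ and any pair of boundary conditions $\tau,\tau'$ on $\Lambda$, $$\|\mu_\Lambda^\tau-\mu_\Lambda^{\tau'}\|_{\Lambda'}\le\beta|\Lambda'|\exp(-\alpha\cdot\mathrm{dist}(\tau\triangle\tau',\Lambda')).$$ Heat-bath dynamics with update radius $L$: the Markov chain on $\Omega_\Lambda^\tau$ (with $\Lambda_{\mathrm{Int}}\neq\emptyset$) which at each step picks $x\in\Lambda_{\mathrm{Int}}^{(L)}=(\Lambda_{\mathrm{Int}})^{(L)}$ uniformly at random and resamples the centers in $B_L(x)$ subject to the boundary conditions induced by $\tau$ and the other centers of the current configuration; i.e. $X_t\cap B_L(x)$ is replaced by a sample of a Poisson process of intensity $\lambda$ on $(\Lambda_{\mathrm{Int}}\setminus\tau)\cap B_L(x)$ conditioned on its union with $X_t\setminus B_L(x)$ having all pairwise distances at least $2r$. Optimal temporal mixing: the heat-bath dynamics with update radius $L$ has optimal temporal mixing on $\mathbb{R}^d$ at fugacity $\lambda$ if there exist $b,c>0$ such that for any compact measurable $\Lambda\subset\mathbb{R}^d$ (for which the chain is defined), with $n=|\Lambda|$, any boundary condition $\tau$, any $s>0$, and any two instances $(X_t),(Y_t)$ of the dynamics on $\Omega_\Lambda^\tau$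 (with arbitrary initial distributions), the total variation distance between the laws of $X_{\lfloor sn\rfloor}$ and $Y_{\lfloor sn\rfloor}$ is at most $b\,n\,e^{-cs}$. *)

(* Defs.v *)
From HB Require Import structures.
From mathcomp Require Import all_boot all_order all_algebra finmap.
From mathcomp Require Import all_classical all_reals all_analysis.

Set Implicit Arguments.
Unset Strict Implicit.
Unset Printing Implicit Defensive.

Import Order.TTheory GRing.Theory Num.Theory.
Import numFieldNormedType.Exports.

Local Open Scope classical_set_scope.
Local Open Scope ring_scope.

Section tuple_measure.
Local Open Scope ereal_scope.
Context {dp : measure_display} {T : measurableType dp} {R : realType}.

Definition tuple_cons n (x : T * n.-tuple T) : n.+1.-tuple T :=
  [tuple of x.1 :: x.2].

Lemma measurable_tuple_cons n :
  measurable_fun [set: T * n.-tuple T] (@tuple_cons n).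
Proof. exact: measurable_cons. Qed.

Definition cons_measure (mu : {sigma_finite_measure set T -> \bar R}) n
    (nu : {sigma_finite_measure set (n.-tuple T) -> \bar R}) :
    set (n.+1.-tuple T) -> \bar R :=
  pushforward (mu \x nu) (@tuple_cons n).

Section cons_measure_instances.
Variables (mu : {sigma_finite_measure set T -> \bar R}) (n : nat).
Variable nu : {sigma_finite_measure set (n.-tuple T) -> \bar R}.

Let cons_measure0 : cons_measure mu nu set0 = 0.
Proof. by rewrite /cons_measure /pushforward preimage_set0 measure0. Qed.

Let cons_measure_ge0 A : 0 <= cons_measure mu nu A.
Proof. by rewrite /cons_measure /pushforward. Qed.

Let measurable_preimage_cons (A : set (n.+1.-tuple T)) :
  measurable A -> measurable (@tuple_cons n @^-1` A).
Proof.
by move=> mA; rewrite -[X in measurable X]setTI; exact: measurable_tuple_cons.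
Qed.

Let cons_measure_sigma_additive : semi_sigma_additive (cons_measure mu nu).
Proof.
move=> F mF tF mUF; rewrite /cons_measure /pushforward preimage_bigcup.
apply: measure_semi_sigma_additive.
- by move=> k; exact: measurable_preimage_cons.
- apply/trivIsetP => /= i j _ _ ij; rewrite -preimage_setI.
  by move/trivIsetP : tF => /(_ _ _ _ _ ij) ->//; rewrite preimage_set0.
- by rewrite -preimage_bigcup; exact: measurable_preimage_cons.
Qed.

HB.instance Definition _ := isMeasure.Build _ _ _ (cons_measure mu nu)
  cons_measure0 cons_measure_ge0 cons_measure_sigma_additive.

Let cons_measure_sigma_finite : sigma_finite setT (cons_measure mu nu).
Proof.
have /sigma_finiteP[F [FT ndF Foo]] := sigma_finiteT mu.
have /sigma_finiteP[G [GT ndG Goo]] := sigma_finiteT nu.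
pose split (t : n.+1.-tuple T) : T * n.-tuple T :=
  (thead t, [tuple of behead t]).
have consK : cancel (@tuple_cons n) split.
  by move=> [x t]; congr pair; apply/val_inj.
have msplit : measurable_fun setT split.
  apply/measurable_fun_pairP; split; first exact: measurable_tnth.
  exact: measurable_behead.
exists (fun k => split @^-1` (F k `*` G k)).
  apply/esym; rewrite -preimage_bigcup -subTset => t _ /=.
  have [k _ Fk] : (\bigcup_k F k) (thead t) by rewrite -FT.
  have [l _ Gl] : (\bigcup_k G k) [tuple of behead t] by rewrite -GT.
  exists (maxn k l) => //; split => /=.
  - by move: Fk; exact/subsetPset/ndF/leq_maxl.
  - by move: Gl; exact/subsetPset/ndG/leq_maxr.
move=> k; have [mF Fk] := Foo k; have [mG Gk] := Goo k; split.
  by rewrite -[X in measurable X]setTI; apply: msplit => //; exact: measurableX.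
rewrite /cons_measure /pushforward -comp_preimage.
rewrite (_ : split \o _ = id); last by apply/funext => x; exact: consK.
by rewrite preimage_id product_measure1E// lte_mul_pinfty// ge0_fin_numE.
Qed.

HB.instance Definition _ := Measure_isSigmaFinite.Build _ _ _
  (cons_measure mu nu) cons_measure_sigma_finite.

End cons_measure_instances.

Fixpoint pow_measure (mu : {sigma_finite_measure set T -> \bar R}) n :
    {sigma_finite_measure set (n.-tuple T) -> \bar R} :=
  match n with
  | 0%N => \d_([tuple] : 0.-tuple T)
  | m.+1 => cons_measure mu (pow_measure mu m)
  end.

End tuple_measure.


Definition measure_row_display : measure_display -> measure_display.
Proof. exact. Qed.

(* The sigma-algebra generated by the coordinates, i.e. the Borel sets of R^d *)
Section borel_row.
Context {R : realType} {d : nat}.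

Let coordinate (i : 'I_d) (x : 'rV[R]_d) : measurableTypeR R := x ord0 i.

Let borel0 : g_sigma_preimage coordinate set0.
Proof. exact: sigma_algebra0. Qed.

Let borelC A :
  g_sigma_preimage coordinate A -> g_sigma_preimage coordinate (~` A).
Proof. exact: sigma_algebraC. Qed.

Let borel_bigcup (F : (set 'rV[R]_d)^nat) :
  (forall i, g_sigma_preimage coordinate (F i)) ->
  g_sigma_preimage coordinate (\bigcup_i F i).
Proof. exact: sigma_algebra_bigcup. Qed.

HB.instance Definition _ :=
  @isMeasurable.Build (measure_row_display (R.-ocitv.-measurable).-sigma)
    'rV[R]_d (g_sigma_preimage coordinate) borel0 borelC borel_bigcup.

Definition row_of_tuple (t : d.-tuple (measurableTypeR R)) : 'rV[R]_d :=
  \row_i tnth t i.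

Lemma measurable_row_of_tuple : measurable_fun setT row_of_tuple.
Proof.
have cs (A : set 'rV[R]_d) : measurable A ->
    preimage_set_system setT row_of_tuple (g_sigma_preimage coordinate)
      (row_of_tuple @^-1` A).
  by move=> mA; exists A => //; rewrite setTI.
move=> _ A mA; rewrite setTI; have := cs _ mA.
rewrite -g_sigma_preimage_comp.
congr (<<s _ >> _); apply: eq_bigr => i _; congr preimage_set_system.
by apply/funext => t; rewrite /coordinate /= mxE.
Qed.

Definition volume (A : set 'rV[R]_d) : \bar R :=
  pushforward (pow_measure lebesgue_measure d) row_of_tuple A.

Let volume0 : volume set0 = 0%E.
Proof. by rewrite /volume /pushforward preimage_set0 measure0. Qed.

Let volume_ge0 A : (0 <= volume A)%E.
Proof. by rewrite /volume /pushforward. Qed.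

Let measurable_preimage_row (A : set 'rV[R]_d) :
  measurable A -> measurable (row_of_tuple @^-1` A).
Proof.
by move=> mA; rewrite -[X in measurable X]setTI; exact: measurable_row_of_tuple.
Qed.

Let volume_sigma_additive : semi_sigma_additive volume.
Proof.
move=> F mF tF mUF; rewrite /volume /pushforward preimage_bigcup.
apply: measure_semi_sigma_additive.
- by move=> k; exact: measurable_preimage_row.
- apply/trivIsetP => /= i j _ _ ij; rewrite -preimage_setI.
  by move/trivIsetP : tF => /(_ _ _ _ _ ij) ->//; rewrite preimage_set0.
- by rewrite -preimage_bigcup; exact: measurable_preimage_row.
Qed.

HB.instance Definition _ := isMeasure.Build _ _ _ volume
  volume0 volume_ge0 volume_sigma_additive.

Let volume_sigma_finite : sigma_finite setT volume.
Proof.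
have [F FT mF] := sigma_finiteT (pow_measure (@lebesgue_measure R) d).
pose coords (x : 'rV[R]_d) : d.-tuple (measurableTypeR R) :=
  [tuple coordinate i x | i < d].
have rowK : cancel row_of_tuple coords.
  by move=> t; apply: eq_from_tnth => i; rewrite tnth_mktuple /coordinate mxE.
have mcoords : measurable_fun setT coords.
  apply/measurable_fun_tnthP => i.
  rewrite (_ : _ \o _ = coordinate i); last first.
    by apply/funext => x /=; rewrite tnth_mktuple.
  move=> _ Y mY; rewrite setTI; apply: sub_sigma_algebra => /=.
  rewrite -bigcup_seq/=; exists i => /=; first by rewrite mem_index_enum.
  by exists Y => //; rewrite setTI.
exists (fun k => coords @^-1` F k).
  by rewrite -preimage_bigcup -FT preimage_setT.
move=> k; have [mFk Fk] := mF k; split.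
  by rewrite -[X in measurable X]setTI; exact: mcoords.
rewrite /volume /pushforward -comp_preimage.
rewrite (_ : coords \o _ = id)//; apply/funext => x; exact: rowK.
Qed.

HB.instance Definition _ := Measure_isSigmaFinite.Build _ _ _ volume
  volume_sigma_finite.

End borel_row.

(* The norm that the library puts on row vectors is the sup norm. *)
Section euclidean_geometry.
Context {R : realType} {d : nat}.
Implicit Types (x y : 'rV[R]_d) (A B : set 'rV[R]_d).

Definition euclidean_dist x y : R :=
  Num.sqrt (\sum_(i < d) (x ord0 i - y ord0 i) ^+ 2).

Definition euclidean_ball x (l : R) : set 'rV[R]_d :=
  [set y | euclidean_dist x y < l].

(* Equal to +oo as soon as one of the two sets is empty *)
Definition set_dist A B : \bar R :=
  ereal_inf [set (euclidean_dist x y)%:E | x in A & y in B].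

Definition thickening A (l : R) : set 'rV[R]_d :=
  [set x | (set_dist [set x] A <= l%:E)%E].

End euclidean_geometry.

Section configurations.
Context {R : realType} {d : nat}.

Definition restriction (A : set 'rV[R]_d) (X : {fset 'rV[R]_d}) :
  {fset 'rV[R]_d} := [fset x in X | x \in A]%fset.

Definition count_events : set (set {fset 'rV[R]_d}) :=
  [set E | exists B k, measurable B /\
     E = [set X | #|` restriction B X| = k]].

Definition config : Type := g_sigma_algebraType count_events.

HB.instance Definition _ := Measurable.on config.

Definition config_of_tuple n (t : n.-tuple 'rV[R]_d) : config :=
  [fset x in tval t]%fset.

Implicit Types (mu nu P : set config -> \bar R) (E H : set config).

(* The Poisson point process of intensity lam on a Borel set S of finite
   volume: the number N of points is Poisson with mean lam |S| and, given N = k,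
   the points are k independent uniform points of S, so that
   P(N = k, X in E) =
     e^(-lam |S|) (lam |S|)^k / k! * |S|^(-k) Leb{t in S^k : {t_1,..,t_k} in E} *)
Definition poisson_process (lam : R) (S : set 'rV[R]_d) E : \bar R :=
  ((expR (- (lam * fine (volume S))))%:E *
   \sum_(0 <= k <oo) ((lam ^+ k / k`!%:R)%:E *
     pow_measure volume k
       [set t | (forall i, S (tnth t i)) /\ E (config_of_tuple t)]))%E.

Definition conditional_law P H E : \bar R := (P (E `&` H) / P H)%E.

Definition total_variation_dist mu nu : \bar R :=
  ereal_sup [set `|mu E - nu E|%E | E in [set E | measurable E]].

End configurations.

Section hard_spheres.
Context {R : realType} {d : nat}.
Variables r lam : R.
Implicit Types (A tau : set 'rV[R]_d) (X Y : @config R d) (E : set (@config R d)).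

Definition hard_core : set (@config R d) :=
  [set X | forall x y, x \in (X : {fset 'rV[R]_d}) ->
     y \in (X : {fset 'rV[R]_d}) -> x != y -> 2 * r <= euclidean_dist x y].

Definition region A : Prop := compact A /\ measurable A.

(* The locations allowed for a center by the region: A_Int *)
Definition centers A : set 'rV[R]_d :=
  [set x | A x /\ (r%:E <= set_dist [set x] (~` A))%E].

Definition boundary_condition A tau : Prop :=
  measurable tau /\ tau `<=` centers A.

Definition configurations A tau : set (@config R d) :=
  [set X | hard_core X /\
     forall x, x \in (X : {fset 'rV[R]_d}) -> (centers A `\` tau) x].

Definition hard_sphere_model A tau : set (@config R d) -> \bar R :=
  conditional_law (poisson_process lam (centers A `\` tau)) hard_core.

Definition local_total_variation A (mu nu : set (@config R d) -> \bar R) :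
    \bar R :=
  total_variation_dist
    (pushforward mu (restriction (centers A) : @config R d -> @config R d))
    (pushforward nu (restriction (centers A) : @config R d -> @config R d)).

Definition strong_spatial_mixing : Prop :=
  exists alpha beta : R, [/\ 0 < alpha, 0 < beta &
    forall A' A, region A' -> region A -> A' `<=` A ->
    forall tau tau', boundary_condition A tau -> boundary_condition A tau' ->
    (local_total_variation A'
       (hard_sphere_model A tau) (hard_sphere_model A tau') <=
     beta%:E * volume A' *
       expeR (- (alpha%:E * set_dist (tau `+` tau') A')))%E].

(* The configuration X with its points in B replaced by Y *)
Definition update (B : set 'rV[R]_d) X Y : @config R d :=
  (restriction (~` B) X `|` Y)%fset.

Definition resample A tau (B : set 'rV[R]_d) X E : \bar R :=
  conditional_law (poisson_process lam ((centers A `\` tau) `&` B))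
    (update B X @^-1` hard_core) (update B X @^-1` E).

Definition heat_bath (L : R) A tau X E : \bar R :=
  ((\int[volume]_(x in thickening (centers A) L)
      resample A tau (euclidean_ball x L) X E) /
   volume (thickening (centers A) L))%E.

(* The sigma-algebra generated by X_0, ..., X_t *)
Definition past (T : Type) (X : nat -> T -> @config R d) (t : nat) :
    set (set T) :=
  <<s \bigcup_(s in [set s | (s <= t)%N])
        preimage_set_system setT (X s) measurable >>.

(* Markov chain, with respect to its own filtration, of transition kernel
   heat_bath and of arbitrary initial law on configurations A tau *)
Definition heat_bath_dynamics (L : R) A tau dT (T : measurableType dT)
    (P : probability T R) (X : nat -> T -> @config R d) : Prop :=
  [/\ forall t, measurable_fun setT (X t),
      forall t w, configurations A tau (X t w) &
      forall t F E, past X t F -> measurable E ->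
        P (F `&` X t.+1 @^-1` E) =
          (\int[P]_(w in F) heat_bath L A tau (X t w) E)%E].

Definition optimal_temporal_mixing (L : R) : Prop :=
  exists b c : R, [/\ 0 < b, 0 < c &
    forall A, region A -> centers A !=set0 ->
    forall tau, boundary_condition A tau ->
    forall s : R, 0 < s ->
    forall dX (TX : measurableType dX) (PX : probability TX R)
      (X : nat -> TX -> @config R d)
      dY (TY : measurableType dY) (PY : probability TY R)
      (Y : nat -> TY -> @config R d),
    heat_bath_dynamics L A tau PX X -> heat_bath_dynamics L A tau PY Y ->
    let n := fine (volume A) in
    let t := Num.truncn (s * n) in
    (total_variation_dist (pushforward PX (X t)) (pushforward PY (Y t)) <=
     (b * n * expR (- (c * s)))%:E)%E].

End hard_spheres.

Arguments strong_spatial_mixing {R} d r lam.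
Arguments optimal_temporal_mixing {R} d r lam L.

(* Main.v *)
Require Import Defs.
From HB Require Import structures.
From mathcomp Require Import all_boot all_order all_algebra finmap.
From mathcomp Require Import all_classical all_reals all_analysis.
From mathcomp Require Import measurable_realfun ring lra.

Set Implicit Arguments.
Unset Strict Implicit.
Unset Printing Implicit Defensive.

Import Order.TTheory GRing.Theory Num.Theory.
Import numFieldNormedType.Exports.

Local Open Scope classical_set_scope.
Local Open Scope ring_scope.

(** Path coupling in dual form. Write P for the heat-bath operator acting on
functions of configurations, and let Lip f be the largest change of f under the
addition of one center to a configuration. Any two configurations are joined by
first deleting and then adding centers one at a time, so it suffices to show
Lip (P f) <= (1 - const / n) Lip f.

Let two configurations differ in the center v. If the update ball B_L(x)
contains v, the two resamplings coincide and the discrepancy disappears. If x is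
at distance at least L + 2r from v, the resampled centers have the same law. In
the remaining annulus, of volume O(L^(d-1)), the two laws in the ball are hard
sphere models whose boundary conditions differ within distance 2r of v: the
centers within distance about K of v number O(K^d), and by strong spatial mixing
those further away are affected with probability O(L^d exp(-alpha K)). With K of
order L^(1/d), the loss from the annulus is at most half of the gain, of order
L^d, from the ball around v. *)

(** * Scaling of Lebesgue measure *)

(** The dual form avoids constructing couplings: only means of functions with values in [0,1] are
    compared, and total variation enters through their superlevel sets. The radius-[r] balls about
    the centers are disjoint, have volume 1 and lie in A, so a configuration is at most n = |A|
    deletions away from the empty one. Indicators have Lip at most 1, so after t steps their images
    differ from the value at the empty configuration by at most n times the t-th power of the
    contraction rate.

    Since strong spatial mixing quantifies over all boundary conditions on A, it applies to this set
    directly. The projection in the mixing hypothesis sees only centers at depth [r] in the window;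
    this dictates the margins of 2r, 3r and 4r in the radii below.

    The gain per step is a constant divided by the volume of the set of update centers. A covering
    by balls about a maximal packing bounds that volume by a constant times n. *)

Section image_measure.
Context d1 d2 (T1 : measurableType d1) (T2 : measurableType d2) (R : realType).
Variables (m : {measure set T1 -> \bar R}) (f : T1 -> T2).
Hypothesis mf : measurable_fun [set: T1] f.

Definition image_measure : {measure set T2 -> \bar R} :=
  measure_function_pushforward__canonical__measure_function_Measure m mf.

Lemma ge0_integral_image (g : T2 -> \bar R) : measurable_fun [set: T2] g ->
  (forall x, 0 <= g x)%E ->
  (\int[image_measure]_x g x = \int[m]_x g (f x))%E.
Proof. by move=> mg g0; rewrite ge0_integral_pushforward. Qed.

End image_measure.

Section lebesgue_affine.
Context {R : realType}.
Implicit Types (u a : R).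

Lemma measurable_affine u a :
  measurable_fun setT ((fun x => u + a * x) : measurableTypeR R -> measurableTypeR R).
Proof. by apply: measurable_funD => //; exact: measurable_funM. Qed.

(** The scaled pushforward is a measure that gives half-open intervals their length, so uniqueness
    of Lebesgue measure identifies the two. *)
Lemma lebesgue_measure_affine u a (A : set (measurableTypeR R)) :
  0 < a -> measurable A ->
  (a%:E * lebesgue_measure ((fun x => (u + a * x)%R) @^-1` A))%E =
  lebesgue_measure A.
Proof.
move=> a0 mA; have a0' := ltW a0.
pose m : {measure set (measurableTypeR R) -> \bar R} :=
  mscale (NngNum a0') (image_measure lebesgue_measure (measurable_affine u a)).
suff mE X : ocitv X -> lebesgue_measure X = m X.
  by rewrite [RHS](lebesgue_measure_unique mE).
move: X => _ [[l h] /= lh <-].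
rewrite /m /mscale /= /pushforward /=.
rewrite (_ : _ @^-1` _ = `](a^-1 * (l - u)), (a^-1 * (h - u))]%classic); last first.
  by apply/seteqP; split => x /=; rewrite !in_itv/=
    ![a^-1 * _]mulrC ltr_pdivrMr// ler_pdivlMr// ltrBlDl lerBrDl [x * a]mulrC.
rewrite !lebesgue_measure_itv /= !lte_fin ltr_pM2l ?invr_gt0// ltrD2r.
case: ifPn => _; last by rewrite mule0.
rewrite -!EFinB -EFinM; congr (_%:E).
by rewrite -mulrBr mulrA divff ?gt_eqF// mul1r opprB addrA subrK.
Qed.

Definition affine_tuple a n (u t : n.-tuple (measurableTypeR R)) :
    n.-tuple (measurableTypeR R) :=
  [tuple tnth u i + a * tnth t i | i < n].

(** One coordinate at a time, by Tonelli: the induction hypothesis rescales each section, and the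
    one-dimensional case changes variables in the outer integral. *)
Lemma pow_measure_affine a n (u : n.-tuple (measurableTypeR R)) A :
  0 < a -> measurable A ->
  ((a ^+ n)%:E * pow_measure lebesgue_measure n (affine_tuple a u @^-1` A))%E =
  pow_measure lebesgue_measure n A.
Proof.
move=> a0; elim: n u A => [u A mA|n IH u A mA] /=.
  rewrite expr0 mul1e !diracE; congr ((_ : bool)%:R%:E).
  by apply/idP/idP; rewrite !inE /= (tuple0 (affine_tuple a u _)) /=.
pose u0 := thead u; pose u' := [tuple of behead u].
have uE : u = [tuple of u0 :: u'] by exact: tuple_eta.
pose C := @tuple_cons _ (measurableTypeR R) n @^-1` A.
have mC : measurable C.
  by rewrite -[X in measurable X]setTI; exact: measurable_tuple_cons.
rewrite /cons_measure /pushforward /= /product_measure1 -/C.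
pose g x := pow_measure lebesgue_measure n (xsection C x).
have mg : measurable_fun setT g by exact: measurable_fun_xsection.
rewrite -/g.
transitivity ((a ^+ n.+1)%:E * \int[lebesgue_measure]_x ((a ^+ n)^-1%:E * g ((u0 + a * x)%R)))%E.
  congr (_ * _)%E; apply: eq_integral => x _ /=.
  have mC' : measurable (xsection C (u0 + a * x)) by exact: measurable_xsection.
  rewrite /g -(IH u' _ mC').
  rewrite muleA -EFinM mulVf ?mul1e ?expf_neq0 ?gt_eqF//.
  congr (pow_measure _ _ _).
  apply/seteqP; split => t; rewrite /xsection /= !inE /C /= /tuple_cons /=;
  (have -> : affine_tuple a u [tuple of x :: t] =
    [tuple of u0 + a * x :: affine_tuple a u' t]; last by []);
  apply/eq_from_tnth => i; rewrite tnth_mktuple uE;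
  (case: (unliftP ord0 i) => [j|] ->; rewrite ?tnthS ?tnth0 ?tnth_mktuple //).
have mgu : measurable_fun setT (fun x : measurableTypeR R => g (u0 + a * x)).
  by apply: (measurableT_comp mg); exact: measurable_affine.
have ai0 : (0 <= (a ^+ n)^-1%:E)%E by rewrite lee_fin invr_ge0 exprn_ge0 // ltW.
rewrite ge0_integralZl//.
rewrite muleA -EFinM exprSr mulrAC divff ?mul1r ?expf_neq0 ?gt_eqF//.
have a0' := ltW a0.
pose m := image_measure lebesgue_measure (measurable_affine u0 a).
rewrite -(@ge0_integral_image _ _ _ _ _ lebesgue_measure _ (measurable_affine u0 a) g)//.
rewrite -(ge0_integral_mscale m measurableT (NngNum a0')) //.
apply: eq_measure_integral => B mB _.
exact: (lebesgue_measure_affine u0 a0 mB).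
Qed.

End lebesgue_affine.

Section row_affine.
Context {R : realType} {d : nat}.
Implicit Types (x y u : 'rV[R]_d) (A : set 'rV[R]_d).

Lemma measurable_coord (i : 'I_d) :
  measurable_fun setT (fun x : 'rV[R]_d => x ord0 i : measurableTypeR R).
Proof.
move=> _ Y mY; rewrite setTI; apply: sub_sigma_algebra => /=.
rewrite -bigcup_seq/=; exists i => /=; first by rewrite mem_index_enum.
by exists Y => //; rewrite setTI.
Qed.

Lemma measurable_to_row dT (T : measurableType dT) (f : T -> 'rV[R]_d) :
  (forall i, measurable_fun setT (fun t => f t ord0 i : measurableTypeR R)) ->
  measurable_fun setT f.
Proof.
move=> mf.
pose g t : d.-tuple (measurableTypeR R) := [tuple f t ord0 i | i < d].
have mg : measurable_fun setT g.
  apply/measurable_fun_tnthP => i; rewrite (_ : _ \o _ = (fun t => f t ord0 i))//.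
  by apply/funext => t /=; rewrite tnth_mktuple.
rewrite (_ : f = @row_of_tuple R d \o g).
  by apply: measurableT_comp => //; exact: measurable_row_of_tuple.
by apply/funext => t; apply/rowP => i; rewrite mxE tnth_mktuple.
Qed.

(** Through this scaling the single normalization at radius [r] determines the volume of every
    ball. *)
Lemma volume_affine a u A : 0 < a -> measurable A ->
  ((a ^+ d)%:E * volume ((fun x => u + a *: x)%R @^-1` A))%E = volume A.
Proof.
move=> a0 mA; rewrite /volume /pushforward.
have mB : measurable (@row_of_tuple R d @^-1` A).
  by rewrite -[X in measurable X]setTI; exact: measurable_row_of_tuple.
rewrite -(pow_measure_affine [tuple (u ord0 i : measurableTypeR R) | i < d] a0 mB).
congr (_ * pow_measure _ _ _)%E.
apply/seteqP; split => t /=.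
  set v := (X in A X -> _); set w := (X in _ -> A X); suff -> : w = v by [].
  by apply/rowP => i; rewrite !mxE /affine_tuple !tnth_mktuple.
set v := (X in A X -> _); set w := (X in _ -> A X); suff -> : w = v by [].
by apply/rowP => i; rewrite !mxE /affine_tuple !tnth_mktuple.
Qed.

End row_affine.

(** * Euclidean geometry *)

Section euclidean.
Context {R : realType} {d : nat}.
Implicit Types (x y z u v : 'rV[R]_d).

Lemma sum_cauchy_schwarz (I : finType) (a b : I -> R) :
  (\sum_i a i * b i) ^+ 2 <= (\sum_i a i ^+ 2) * (\sum_i b i ^+ 2).
Proof.
set A := \sum_i a i ^+ 2; set B := \sum_i b i ^+ 2; set C := \sum_i a i * b i.
have B0 : 0 <= B by apply: sumr_ge0 => i _; exact: sqr_ge0.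
have : 0 <= \sum_i (B * a i - C * b i) ^+ 2.
  by apply: sumr_ge0 => i _; exact: sqr_ge0.
have -> : \sum_i (B * a i - C * b i) ^+ 2 = B * (A * B - C ^+ 2).
  transitivity (\sum_i (B ^+ 2 * a i ^+ 2 + (- (2 * B * C)) * (a i * b i) +
      C ^+ 2 * b i ^+ 2)).
    by apply: eq_bigr => i _; ring.
  by rewrite !big_split/= -!mulr_sumr -/A -/B -/C; ring.
have [B_gt0|] := ltP 0 B; first by rewrite pmulr_rge0// subr_ge0.
move=> B_le0 _; have Be0 : B = 0 by apply/eqP; rewrite eq_le B_le0 B0.
have b0 i : b i = 0.
  apply/eqP; rewrite -sqrf_eq0 eq_le sqr_ge0 andbT -[leRHS]Be0 /B (bigD1 i)//= lerDl.
  by apply: sumr_ge0 => j _; exact: sqr_ge0.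
by rewrite /C big1 ?expr0n/= ?Be0 ?mulr0// => i _; rewrite b0 mulr0.
Qed.

Lemma edist_ge0 x y : 0 <= euclidean_dist x y.
Proof. exact: sqrtr_ge0. Qed.

Lemma edistC x y : euclidean_dist x y = euclidean_dist y x.
Proof.
by congr Num.sqrt; apply: eq_bigr => i _; rewrite -opprB sqrrN.
Qed.

Lemma edistxx x : euclidean_dist x x = 0.
Proof.
by rewrite /euclidean_dist big1 ?sqrtr0// => i _; rewrite subrr expr0n.
Qed.

Lemma edist_coord x y i : `|x ord0 i - y ord0 i| <= euclidean_dist x y.
Proof.
rewrite -sqrtr_sqr ler_sqrt; last by apply: sumr_ge0 => *; exact: sqr_ge0.
by rewrite (bigD1 i)//= lerDl; apply: sumr_ge0 => *; exact: sqr_ge0.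
Qed.

Lemma edist_eq0 x y : euclidean_dist x y = 0 -> x = y.
Proof.
move=> xy0; apply/rowP => i; apply/eqP; rewrite -subr_eq0 -normr_le0 -xy0.
exact: edist_coord.
Qed.

Lemma edist_triangle y x z :
  euclidean_dist x z <= euclidean_dist x y + euclidean_dist y z.
Proof.
rewrite -(@ler_pXn2r _ 2)// ?nnegrE ?addr_ge0 ?edist_ge0//.
have s0 p q : 0 <= \sum_(i < d) (p ord0 i - q ord0 i :> R) ^+ 2.
  by apply: sumr_ge0 => i _; exact: sqr_ge0.
rewrite sqrrD !sqr_sqrtr//.
pose a i := x ord0 i - y ord0 i; pose b i := y ord0 i - z ord0 i.
have -> : \sum_(i < d) (x ord0 i - z ord0 i) ^+ 2 =
    \sum_i a i ^+ 2 + (\sum_i a i * b i) *+ 2 + \sum_i b i ^+ 2.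
  rewrite -sumrMnl -!big_split/=; apply: eq_bigr => i _.
  by rewrite /a /b; ring.
rewrite lerD2r lerD2l lerMn2r/= (le_trans (ler_norm _))//.
rewrite -[leRHS]ger0_norm ?mulr_ge0 ?edist_ge0//.
rewrite -ler_sqr ?nnegrE// !real_normK ?num_real// exprMn !sqr_sqrtr//.
exact: sum_cauchy_schwarz.
Qed.

Lemma edist_affine a u x y : 0 <= a ->
  euclidean_dist (u + a *: x) (u + a *: y) = a * euclidean_dist x y.
Proof.
move=> a0; rewrite /euclidean_dist -[X in X * _](ger0_norm a0) -sqrtr_sqr -sqrtrM ?sqr_ge0//.
by congr Num.sqrt; rewrite mulr_sumr; apply: eq_bigr => i _; rewrite !mxE; ring.
Qed.

Lemma measurable_edist dT (T : measurableType dT) (f g : T -> 'rV[R]_d) :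
  measurable_fun setT f -> measurable_fun setT g ->
  measurable_fun setT (fun t => euclidean_dist (f t) (g t)).
Proof.
move=> mf mg.
apply: (@measurableT_comp _ _ _ _ _ _ (@Num.sqrt R)).
  apply: continuous_measurable_fun; exact: sqrt_continuous.
apply: measurable_sum => i; apply: measurable_funX.
by apply: measurable_funB; apply: (measurableT_comp (measurable_coord i)).
Qed.

Lemma measurable_eball x l : measurable (euclidean_ball x l).
Proof.
have mf : measurable_fun setT (fun y : 'rV[R]_d => euclidean_dist x y).
  by apply: measurable_edist.
have := mf measurableT [set` `]-oo, l[ ]; rewrite setTI.
rewrite (_ : _ @^-1` _ = euclidean_ball x l); first by apply.
by apply/seteqP; split => y; rewrite /euclidean_ball/= in_itv.
Qed.

Definition closed_eball x l : set 'rV[R]_d := [set y | euclidean_dist x y <= l].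

Lemma measurable_closed_eball x l : measurable (closed_eball x l).
Proof.
have mf : measurable_fun setT (fun y : 'rV[R]_d => euclidean_dist x y).
  by apply: measurable_edist.
have := mf measurableT [set` `]-oo, l] ]; rewrite setTI.
rewrite (_ : _ @^-1` _ = closed_eball x l); first by apply.
by apply/seteqP; split => y; rewrite /closed_eball/= in_itv.
Qed.

Lemma continuous_edist x : continuous (fun y => euclidean_dist x y).
Proof.
move=> y; apply: (@continuous_comp _ _ _ _ (@Num.sqrt R)); last exact: sqrt_continuous.
apply: (@cvg_big R 'I_d +%R 0 xpredT (@add_continuous R) _ _ _
  (fun i z => (x ord0 i - z ord0 i) ^+ 2)); first exact: nbhs_filter.
move=> i _; apply: (@cvg_comp _ _ _ (fun z : 'rV[R]_d => z ord0 i)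
  (fun t : R => (x ord0 i - t) ^+ 2)); first exact: coord_continuous.
apply: (@continuous_comp _ _ _ (fun t : R => x ord0 i - t) (fun t : R => t ^+ 2)).
  by apply: cvgB; [exact: cvg_cst|exact: cvg_id].
exact: exprn_continuous.
Qed.

Lemma closed_closed_eball x l : closed (closed_eball x l).
Proof.
rewrite (_ : closed_eball x l = (fun y => euclidean_dist x y) @^-1` [set s | s <= l]);
  last by [].
by apply: closed_comp => [y _|]; [exact: continuous_edist|exact: closed_le].
Qed.

Lemma open_eball x l : open (euclidean_ball x l).
Proof.
rewrite (_ : euclidean_ball x l = (fun y => euclidean_dist x y) @^-1` [set s | s < l]);
  last by [].
by apply: open_comp => [y _|]; [exact: continuous_edist|exact: open_lt].
Qed.

End euclidean.

Section set_distance.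
Context {R : realType} {d : nat}.
Implicit Types (x y z u v : 'rV[R]_d) (A B C : set 'rV[R]_d).

Lemma set_dist_ge A B (l : \bar R) :
  (forall x y, A x -> B y -> (l <= (euclidean_dist x y)%:E)%E) ->
  (l <= set_dist A B)%E.
Proof. by move=> h; apply: le_ereal_inf_tmp => _ [x Ax [y By <-]]; exact: h. Qed.

Lemma set_dist_le A B x y : A x -> B y ->
  (set_dist A B <= (euclidean_dist x y)%:E)%E.
Proof. by move=> Ax By; apply: ereal_inf_lbound; exists x => //; exists y. Qed.

Lemma set_dist_lt A B (l : R) : (set_dist A B < l%:E)%E ->
  exists x y, [/\ A x, B y & euclidean_dist x y < l].
Proof. by move=> /ereal_inf_lt[_ [x Ax [y By <-]]]; rewrite lte_fin; exists x, y. Qed.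

Definition open_thickening C (l : R) : set 'rV[R]_d :=
  [set x | exists2 y, C y & euclidean_dist x y < l].

Lemma rational_approx x (e : R) : 0 < e ->
  exists q : 'rV[rat]_d, euclidean_dist x (map_mx ratr q) < e.
Proof.
(* Dividing by [d.+1] keeps the sum of [d] squared errors strictly below [e ^+ 2], also for [d]
   zero. *)
move=> e0; pose dl := e / d.+1%:R.
have dl0 : 0 < dl by rewrite divr_gt0.
have /choice[q qP] : forall i : 'I_d, exists q : rat, `|x ord0 i - ratr q| < dl.
  move=> i; have [|q] := @rat_in_itvoo R (x ord0 i - dl) (x ord0 i + dl).
    by rewrite ltrBlDr -addrA ltrDl addr_gt0.
  by rewrite in_itv/= => /andP[h1 h2]; exists q; rewrite ltr_distlC h1.
exists (\row_i q i); rewrite -(@ltr_pXn2r _ 2)// ?nnegrE ?edist_ge0 ?ltW//.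
rewrite sqr_sqrtr; last by apply: sumr_ge0 => *; exact: sqr_ge0.
apply: (@le_lt_trans _ _ (\sum_(i < d) dl ^+ 2)).
  apply: ler_sum => i _; rewrite !mxE -real_normK ?num_real//.
  by rewrite ler_sqr ?nnegrE ?normr_ge0 ?(ltW dl0)//; exact: ltW (qP i).
rewrite sumr_const card_ord -mulr_natl /dl expr_div_n mulrCA gtr_pMr ?exprn_gt0//.
rewrite ltr_pdivrMr ?exprn_gt0// mul1r -natrX ltr_nat.
by rewrite -mulnn mulSn (leq_trans (ltnSn d) (leq_addr _ _)).
Qed.

(** [C] is arbitrary, so openness has to do the work: the set is a countable union of balls with
    rational center and radius, which are measurable for the sigma-algebra generated by the
    coordinates. *)
Lemma measurable_open_thickening C (l : R) : measurable (open_thickening C l).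
Proof.
pose F (p : 'rV[rat]_d * rat) : set 'rV[R]_d :=
  if `[< open_thickening C (l - ratr p.2) (map_mx ratr p.1) >]
  then euclidean_ball (map_mx ratr p.1) (ratr p.2) else set0.
rewrite (_ : open_thickening C l = \bigcup_p F p).
  apply: countable_bigcupT_measurable; first exact: countableP.
  by move=> p; rewrite /F; case: ifP => // _; exact: measurable_eball.
apply/seteqP; split => [x [y Cy xy]|x [p _]].
  (* One third of the slack goes to the rational center, one third to the radius around it. *)
  pose e := (l - euclidean_dist x y) / 3.
  have e0 : 0 < e by rewrite divr_gt0// subr_gt0.
  have [q xq] := rational_approx x e0.
  have [s] := @rat_in_itvoo R (euclidean_dist x (map_mx ratr q)) e xq.
  rewrite in_itv/= => /andP[s1 s2].
  exists (q, s) => //; rewrite /F/= asboolT; first by rewrite /euclidean_ball/= edistC.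
  exists y => //; rewrite (le_lt_trans (edist_triangle x _ _))// edistC.
  have : l = euclidean_dist x y + 3 * e by rewrite /e mulrC divfK// addrC subrK.
  lra.
rewrite /F; case: asboolP => // -[y Cy py] xp.
exists y => //; rewrite (le_lt_trans (edist_triangle (map_mx ratr p.1) _ _))//.
move: xp; rewrite /euclidean_ball/= edistC; lra.
Qed.

(** The infimum in [set_dist] need not be attained, so the closed thickening is only a limit of open
    ones. *)
Lemma thickeningE C (l : R) :
  thickening C l = \bigcap_n open_thickening C (l + n.+1%:R^-1).
Proof.
apply/seteqP; split => [x /= xC n _|x xC].
  have /set_dist_lt[_ [y [-> Cy xy]]] : (set_dist [set x] C < (l + n.+1%:R^-1)%:E)%E.
    by rewrite (le_lt_trans xC)// lte_fin ltrDl invr_gt0.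
  by exists y.
rewrite /thickening/=; apply/lee_addgt0Pr => e e0.
have [n _ ne] := near_infty_natSinv_lt (PosNum e0).
have [y Cy xy] := xC n I.
rewrite (le_trans (@set_dist_le _ _ x y _ Cy))// -EFinD lee_fin.
rewrite (le_trans (ltW xy))// lerD2l ltW//; exact: (ne n (leqnn n)).
Qed.

Lemma measurable_thickening C (l : R) : measurable (thickening C l).
Proof.
rewrite thickeningE; apply: bigcap_measurable; first by exists 0%N.
by move=> n _; exact: measurable_open_thickening.
Qed.

Lemma centersP (r : R) A x :
  centers r A x <-> A x /\ forall y, ~ A y -> r <= euclidean_dist x y.
Proof.
split=> [[Ax h]|[Ax h]]; split => //.
  by move=> y nAy; rewrite -lee_fin (le_trans h)//; exact: set_dist_le.
by apply: set_dist_ge => _ y -> /h; rewrite lee_fin.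
Qed.

Lemma measurable_centers (r : R) A : measurable A -> measurable (centers r A).
Proof.
move=> mA; rewrite (_ : centers r A = A `\` open_thickening (~` A) r).
  by apply: measurableD => //; exact: measurable_open_thickening.
apply/seteqP; split => [x /centersP[Ax h]|x [Ax h]].
  by split => // -[y /h]; rewrite leNgt => /negP.
by apply/centersP; split => // y nAy; rewrite leNgt; apply/negP => xy; apply: h; exists y.
Qed.

Lemma centers_sub (r : R) A : centers r A `<=` A. Proof. by move=> x []. Qed.

Lemma centers_ball (r : R) A x : centers r A x -> euclidean_ball x r `<=` A.
Proof.
move=> /centersP[_ h] y xy; apply: contrapT => /h.
by rewrite leNgt => /negP; apply.
Qed.

End set_distance.

(** * Ball volumes and packing bounds *)

Section volumes.
Context {R : realType} {d : nat} (r : R) (r_gt0 : 0 < r)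
  (ball_volume : volume (euclidean_ball (0 : 'rV[R]_d) r) = 1%E).
Implicit Types (x y v : 'rV[R]_d) (A B : set 'rV[R]_d) (X : {fset 'rV[R]_d}).

Lemma volume_eball x l : 0 < l ->
  volume (euclidean_ball x l) = ((l / r) ^+ d)%:E.
Proof.
move=> l0; have a0 : 0 < l / r by rewrite divr_gt0.
rewrite -(volume_affine x a0 (measurable_eball x l)).
rewrite (_ : _ @^-1` _ = euclidean_ball 0 r) ?ball_volume ?mule1//.
have E y : euclidean_dist x (x + (l / r) *: y) = l / r * euclidean_dist 0 y.
  by rewrite -(edist_affine x 0 y (ltW a0)) scaler0 addr0.
have lE t : (l / r * t < l) = (t < r) by rewrite mulrAC ltr_pdivrMr// ltr_pM2l.
by apply/seteqP; split => y; rewrite /euclidean_ball/= E lE.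
Qed.

(** The balls of radius [r] about the points are disjoint by the hard core condition, have volume 1
    and lie in [A]. *)
Lemma packing_bound X A : measurable A -> hard_core r X ->
  (forall x, x \in X -> euclidean_ball x r `<=` A) ->
  ((#|` X|)%:R%:E <= volume A)%E.
Proof.
move=> mA hX XA.
have mb x : measurable (euclidean_ball x r) by exact: measurable_eball.
apply: (@le_trans _ _ (volume (\big[setU/set0]_(x <- X) euclidean_ball x r))).
  rewrite measure_fbigsetU//=.
    rewrite (eq_bigr (fun _ => 1%E)); last first.
      by move=> x _; rewrite volume_eball// divff ?gt_eqF// expr1n.
    by rewrite sumEFin big_const_seq count_predT iter_addr_0.
  apply/trivIsetP => x y /= xX yX xy.
  rewrite -subset0 => z [xz yz]; have := hX x y xX yX xy.
  rewrite leNgt => /negP; apply; rewrite (le_lt_trans (edist_triangle z _ _))//.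
  by rewrite (edistC z) mulr_natl mulr2n ltrD.
apply: le_measure; rewrite ?inE//; first exact: bigsetU_measurable.
by rewrite -bigcup_seq => z [x xX xz]; exact: XA xX _ xz.
Qed.

Lemma packing_ball v l X : 0 < l -> hard_core r X ->
  (forall x, x \in X -> euclidean_dist v x < l) ->
  (#|` X|)%:R <= ((l + r) / r) ^+ d.
Proof.
move=> l0 hX Xl; rewrite -lee_fin -(volume_eball v); last by rewrite addr_gt0.
apply: packing_bound => //; first exact: measurable_eball.
move=> x xX y xy; rewrite /euclidean_ball/= (le_lt_trans (edist_triangle x _ _))//.
by rewrite ltrD// Xl.
Qed.

End volumes.

(** * Measurability of configurations *)

Section counting.
Context {R : realType} {d : nat}.
Local Notation row := 'rV[R]_d.
Local Notation config := (@config R d).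
Implicit Types (A B : set row) (X Y : {fset row}).

Definition count_in A X : nat := #|` restriction A X|.

Lemma in_restriction A X x : (x \in restriction A X) = (x \in X) && (x \in A).
Proof. by rewrite !inE/=. Qed.

Lemma eq_count_in A B X : (forall x, x \in X -> A x <-> B x) ->
  count_in A X = count_in B X.
Proof.
move=> AB; congr #|` _|; apply/fsetP => x; rewrite !in_restriction.
case: (boolP (x \in X)) => //= /AB h.
by apply/idP/idP; rewrite !inE => /h.
Qed.

Lemma count_inD A B X : B `<=` A ->
  count_in A X = (count_in (A `\` B) X + count_in B X)%N.
Proof.
move=> BA; rewrite /count_in.
have -> : restriction A X = (restriction (A `\` B) X `|` restriction B X)%fset.
  apply/fsetP => x; rewrite in_fsetU !in_restriction -andb_orr; congr andb.
  rewrite in_setD; apply/idP/orP => [xA|[/andP[]//|]].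
    by case: (boolP (x \in B)) => xB; [right|left; rewrite xA].
  by rewrite !inE => /BA.
rewrite cardfsU (_ : (_ `&` _)%fset = fset0) ?cardfs0 ?subn0//.
apply/fsetP => x; rewrite in_fsetI !in_restriction in_setD in_fset0.
by case: (x \in B); rewrite !(andbF, andFb).
Qed.

Lemma measurable_count_in dT (T : measurableType dT) (X : T -> config) B k :
  measurable_fun setT X -> measurable B ->
  measurable [set t | count_in B (X t) = k].
Proof.
move=> mX mB; rewrite -[X in measurable X]setTI.
by apply: (mX measurableT [set Y | count_in B Y = k]); apply: sub_sigma_algebra; exists B, k.
Qed.

Lemma measurable_to_config dT (T : measurableType dT) (X : T -> config) :
  (forall B k, measurable B -> measurable [set t | count_in B (X t) = k]) ->
  measurable_fun setT X.
Proof.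
move=> h; apply: (@measurability _ _ T config setT X (@count_events R d)) => //.
by move=> _ [_ [B [k [mB ->]]] <-]; rewrite setTI; exact: h.
Qed.

(** A finite configuration meets an increasing union in points that have all entered by some index;
    this makes counts continuous along increasing windows. *)
Lemma stationary_on_seq (T : eqType) (F : (set T)^nat) (s : seq T) :
  nondecreasing_seq F ->
  exists N, forall n, (N <= n)%N -> forall x, x \in s ->
    (\bigcup_n F n) x <-> F n x.
Proof.
move=> ndF; have Fle n m x : (n <= m)%N -> F n x -> F m x.
  by move=> nm; move: x; apply/subsetPset/ndF.
elim: s => [|a s [N hN]]; first by exists 0%N.
have [[M _ FM]|nF] := pselect ((\bigcup_n F n) a).
  exists (maxn M N) => n; rewrite geq_max => /andP[Mn Nn] x.
  rewrite inE => /orP[/eqP ->|/(hN _ Nn)//]; split => _; last by exists M.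
  exact: Fle FM.
exists N => n Nn x; rewrite inE => /orP[/eqP ->|/(hN _ Nn)//].
by split => // Fa; exists n.
Qed.

(** The window [xsection D t] moves with the sample, as an update ball with random center does, so
    the generating counting events do not apply directly. The claim holds on rectangles and passes
    to all measurable [D] by a monotone class argument. *)
Lemma measurable_moving_count dT (T : measurableType dT) (X : T -> config)
    (D : set (T * row)) k :
  measurable_fun setT X -> measurable D ->
  measurable [set t | count_in (xsection D t) (X t) = k].
Proof.
move=> mX.
pose c (D : set (T * row)) t := count_in (xsection D t) (X t).
rewrite -/(c D); move: k; move: D.
pose H : set (set (T * row)) := [set D | forall k, measurable [set t | c D t = k]].
suff : measurable `<=` H by move=> h D k /h.
rewrite measurable_prod_measurableType.
set C := [set A `*` B | A in measurable & B in measurable].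
have CI : setI_closed C.
  move=> _ _ [X1 mX1 [X2 mX2 <-]] [Y1 mY1 [Y2 mY2 <-]].
  exists (X1 `&` Y1); first exact: measurableI.
  by exists (X2 `&` Y2); [exact: measurableI|rewrite setXI].
have CH : C `<=` H.
  move=> _ [A mA [B mB <-]] k.
  have cE t : c (A `*` B) t = if t \in A then count_in B (X t) else 0%N.
    rewrite /c; case: ifPn => tA; first by rewrite in_xsectionX.
    rewrite notin_xsectionX// /count_in; apply/eqP; rewrite cardfs_eq0.
    by apply/eqP/fsetP => x; rewrite in_restriction in_set0 andbF in_fset0.
  rewrite (_ : [set _ | _] = (A `&` [set t | count_in B (X t) = k]) `|`
      (~` A `&` [set t | 0%N = k])); last first.
    apply/seteqP; split => t /=; rewrite cE; case: ifPn; rewrite ?inE ?notin_setE.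
    - by left.
    - by right.
    - by move=> tA [[]|[]].
    - by move=> tA [[]|[]].
  apply: measurableU; apply: measurableI => //.
  - exact: measurable_count_in.
  - exact: measurableC.
  - have [<-|k0] := eqVneq 0%N k.
      by rewrite (_ : [set _ | _] = setT)//; apply/seteqP; split.
    rewrite (_ : [set _ | _] = set0)//; apply/seteqP; split => // t /= /eqP.
    by rewrite (negbTE k0).
(* Under proper differences the counts subtract; under increasing unions the count is eventually
   constant. *)
suff lsystem : lambda_system setT H by exact: lambda_system_subset.
split => //.
- move=> k; rewrite (_ : [set _ | _] = [set t | count_in setT (X t) = k]).
    exact: measurable_count_in.
  by apply/seteqP; split => t /=; rewrite /c (_ : xsection setT t = setT)//;
    apply/seteqP; split => y //= _; rewrite /xsection/= inE.
- move=> A B BA HA HB k.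
  rewrite (_ : [set _ | _] = \bigcup_j ([set t | c B t = j] `&`
      [set t | c A t = (k + j)%N])).
    by apply: bigcupT_measurable => j; apply: measurableI; [exact: HB|exact: HA].
  have cE t : c A t = (c (A `\` B) t + c B t)%N.
    by rewrite /c xsectionD; apply: count_inD; exact: le_xsection.
  apply/seteqP; split => t /=; first by move=> <-; exists (c B t); split => //=.
  by move=> [j _ [/= <-]]; rewrite cE => /addIn.
- move=> F ndF HF k.
  have st t : exists N, forall n, (N <= n)%N -> c (F n) t = c (\bigcup_n F n) t.
    have [|N hN] := @stationary_on_seq _ (fun n => xsection (F n) t) (X t : {fset row}).
      by move=> m n mn; apply/subsetPset/le_xsection/subsetPset/ndF.
    exists N => n Nn; apply: eq_count_in => x /(hN _ Nn).
    by rewrite -xsection_bigcup => -[h1 h2]; split.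
  rewrite (_ : [set _ | _] = \bigcup_N \bigcap_(n in [set n | (N <= n)%N])
      [set t | c (F n) t = k]).
    apply: bigcupT_measurable => N; apply: bigcap_measurable; first by exists N => /=.
    by move=> n _; exact: HF.
  apply/seteqP; split => t /=.
    by have [N hN] := st t; move=> <-; exists N => // n /= /hN.
  move=> [M _ hM]; have [N hN] := st t.
  by rewrite -(hN (maxn M N)) ?leq_maxr//; apply: hM; rewrite /= leq_maxl.
Qed.

Lemma measurable_edist_lt dT (T : measurableType dT) (f g : T -> row) (l : R) :
  measurable_fun setT f -> measurable_fun setT g ->
  measurable [set t | euclidean_dist (f t) (g t) < l].
Proof.
move=> mf mg; have := measurable_edist mf mg measurableT (measurable_itv `]-oo, l[).
by rewrite setTI; congr measurable; apply/seteqP; split => t /=; rewrite in_itv.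
Qed.

Lemma measurable_row_eq dT (T : measurableType dT) (f g : T -> row) :
  measurable_fun setT f -> measurable_fun setT g ->
  measurable [set t | f t = g t].
Proof.
move=> mf mg; have := measurable_edist mf mg measurableT (measurable_itv `]-oo, 0]).
rewrite setTI; congr measurable; apply/seteqP; split => t /=; rewrite in_itv/=.
  by move=> h; apply: edist_eq0; apply/eqP; rewrite eq_le h edist_ge0.
by move=> ->; rewrite edistxx.
Qed.

Lemma measurable_add_point dT (T : measurableType dT) (X : T -> config) (x : T -> row) :
  measurable_fun setT X -> measurable_fun setT x ->
  measurable_fun setT ((fun t => x t |` X t)%fset : T -> config).
Proof.
move=> mX mx; apply: measurable_to_config => B k mB.
(* The window omits [x t], which may already belong to [X t] and must not be counted twice. *)
pose D := (snd @^-1` B) `&` ~` [set q : T * row | q.2 = x q.1].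
have mD : measurable D.
  apply: measurableI.
    by rewrite -[X in measurable X]setTI; exact: measurable_snd.
  apply: measurableC; apply: measurable_row_eq; first exact: measurable_snd.
  by apply: (measurableT_comp mx); exact: measurable_fst.
have cE t : count_in B (x t |` X t)%fset =
    ((x t \in B) + count_in (xsection D t) (X t))%N.
  rewrite /count_in (_ : restriction B _ =
    ((if x t \in B then [fset x t] else fset0) `|` restriction (xsection D t) (X t))%fset).
    rewrite cardfsU (_ : (_ `&` _)%fset = fset0) ?cardfs0 ?subn0.
      by case: ifP; rewrite ?cardfs1 ?cardfs0.
    apply/fsetP => y; rewrite in_fsetI in_restriction in_fset0; apply/negbTE/negP.
    move=> /andP[+ /andP[_]]; rewrite /xsection inE/= inE => h [_ /=]; apply.
    by move: h; case: ifP; rewrite ?in_fset1 ?in_fset0// => _ /eqP.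
  apply/fsetP => y; rewrite in_fsetU !in_restriction in_fset1U.
  have [->|yx] := eqVneq y (x t) => /=.
    case: ifPn => _; first by rewrite in_fset1 eqxx.
    rewrite in_fset0/=; apply/esym/negbTE/negP => /andP[_].
    by rewrite /xsection inE/= inE => -[_]; exact.
  rewrite (_ : (y \in if _ then _ else _) = false) /=; last first.
    by case: ifP => _; rewrite ?in_fset1 ?in_fset0 ?(negbTE yx).
  congr andb; rewrite /xsection; apply/idP/idP; rewrite !inE/= ?inE.
    by move=> yB; split => //; apply/eqP.
  by case.
rewrite (_ : [set _ | _] =
   (x @^-1` B `&` [set t | (1 + count_in (xsection D t) (X t))%N = k]) `|`
   (~` (x @^-1` B) `&` [set t | count_in (xsection D t) (X t) = k])); last first.
  apply/seteqP; split => t /=; rewrite cE.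
    by case: (boolP (x t \in B)); rewrite ?inE ?notin_setE => xB; [left|right].
  by move=> [[xB]|[xB]] <-; [rewrite mem_set|rewrite memNset].
have mxB : measurable (x @^-1` B) by rewrite -[X in measurable X]setTI; exact: mx.
apply: measurableU; apply: measurableI => //.
- case: k => [|k].
    by rewrite (_ : [set _ | _] = set0)//; apply/seteqP; split.
  rewrite (_ : [set _ | _] = [set t | count_in (xsection D t) (X t) = k]).
    exact: measurable_moving_count.
  by apply/seteqP; split => t /= => [[]|->].
- exact: measurableC.
- exact: measurable_moving_count.
Qed.

Lemma measurable_add_tuple dT (T : measurableType dT) (X : T -> config) n
    (z : T -> n.-tuple row) :
  measurable_fun setT X -> measurable_fun setT z ->
  measurable_fun setT ((fun t => X t `|` config_of_tuple (z t))%fset : T -> config).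
Proof.
move=> mX; elim: n z => [|n IH] z mz.
  rewrite (_ : (fun _ => _) = X)//; apply/funext => t; apply/fsetP => x.
  by rewrite in_fsetU /config_of_tuple (tuple0 (z t)) !inE orbF.
rewrite (_ : (fun _ => _) = (fun t => (tnth (z t) ord0) |`
    (X t `|` config_of_tuple [tuple of behead (z t)]))%fset).
  apply: measurable_add_point.
    by apply: IH; exact: (measurableT_comp (@measurable_behead _ _ _) mz).
  exact: (measurableT_comp (@measurable_tnth _ _ _ ord0) mz).
apply/funext => t; apply/fsetP => x; rewrite in_fset1U !in_fsetU.
rewrite /config_of_tuple !inE/= (tuple_eta (z t)) tnth0 /= inE.
by rewrite orbCA.
Qed.

Lemma measurable_moving_restriction dT (T : measurableType dT) (X : T -> config)
    (D : set (T * row)) :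
  measurable_fun setT X -> measurable D ->
  measurable_fun setT (fun t => restriction (xsection D t) (X t) : config).
Proof.
move=> mX mD; apply: measurable_to_config => B k mB.
rewrite (_ : [set _ | _] =
    [set t | count_in (xsection (D `&` (snd @^-1` B)) t) (X t) = k]).
  apply: measurable_moving_count => //; apply: measurableI => //.
  by rewrite -[X in measurable X]setTI; exact: measurable_snd.
apply/seteqP; split => t /=; rewrite /count_in.
  move=> <-; congr #|` _|; apply/fsetP => x; rewrite !in_restriction -andbA; congr andb.
  by apply/idP/andP; rewrite /xsection/= !inE/= !inE/=.
move=> <-; congr #|` _|; apply/fsetP => x; rewrite !in_restriction -andbA; congr andb.
by apply/andP/idP; rewrite /xsection/= !inE/= !inE/=.
Qed.

End counting.

(** * Hard sphere laws *)

Lemma ge0_integral_mrestr d (T : measurableType d) (R : realType)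
    (mu : {measure set T -> \bar R}) (D : set T) (mD : measurable D)
    (f : T -> \bar R) : measurable_fun [set: T] f -> (forall x, 0 <= f x)%E ->
  (\int[mrestr mu mD]_x f x = \int[mu]_(x in D) f x)%E.
Proof.
move=> mf f0.
rewrite (@ge0_negligible_integral _ _ _ _ setT (~` D))//.
- rewrite setDE setCK setTI; apply: eq_measure_integral => A mA AD.
  by rewrite /= /mrestr setIidl.
- exact: measurableC.
- by rewrite /= /mrestr setICl measure0.
Qed.

Section gibbs.
Context {R : realType} {d : nat} (r lam : R) (lam_ge0 : 0 <= lam).
Local Notation row := 'rV[R]_d.
Local Notation config := (@config R d).
Local Notation vol k := (pow_measure (@volume R d) k).
Implicit Types (S A B : set row) (X Y Z : {fset row}).

Definition admissible S k : set (k.-tuple row) :=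
  [set t | (forall i, S (tnth t i)) /\ hard_core r (config_of_tuple t)].
Arguments admissible S k : clear implicits.

Lemma in_config_of_tuple k (t : k.-tuple row) x :
  (x \in (config_of_tuple t : {fset row})) = (x \in tval t).
Proof. by rewrite /config_of_tuple !inE. Qed.

Lemma measurable_moving_admissible dT (T : measurableType dT) k
    (D : set (T * row)) (z : T -> k.-tuple row) :
  measurable D -> measurable_fun setT z ->
  measurable [set t | admissible (xsection D t) k (z t)].
Proof.
move=> mD mz.
have mzi i : measurable_fun setT (fun t => tnth (z t) i).
  exact: (measurableT_comp (@measurable_tnth _ _ _ i) mz).
(* Entries may coincide, because [config_of_tuple] forgets multiplicities; hence the union with the
   diagonal. *)
rewrite (_ : [set _ | _] =
  (\bigcap_(i in [set: 'I_k]) ((fun t => (t, tnth (z t) i)) @^-1` D)) `&`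
  (\bigcap_(i in [set: 'I_k]) \bigcap_(j in [set: 'I_k])
     ([set t | tnth (z t) i = tnth (z t) j] `|`
      ~` [set t | euclidean_dist (tnth (z t) i) (tnth (z t) j) < 2 * r]))).
  apply: measurableI; first (apply: fin_bigcap_measurable => // i _).
    rewrite -[X in measurable X]setTI.
    suff : measurable_fun setT (fun t => (t, tnth (z t) i)) by exact.
    exact: measurable_fun_pair.
  apply: fin_bigcap_measurable => // i _; apply: fin_bigcap_measurable => // j _.
  apply: measurableU; first exact: measurable_row_eq.
  by apply: measurableC; exact: measurable_edist_lt.
apply/seteqP; split => t /=.
  move=> [zD hz]; split.
    by move=> i _; have := zD i; rewrite /xsection/= inE.
  move=> i _ j _ /=; have [->|zij] := eqVneq (tnth (z t) i) (tnth (z t) j); first by left.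
  right; apply/negP; rewrite -leNgt; apply: hz => //;
    by rewrite in_config_of_tuple mem_tnth.
move=> [zD hz]; split.
  by move=> i; rewrite /xsection/= inE; exact: zD.
move=> x y; rewrite !in_config_of_tuple => /tnthP[i ->] /tnthP[j ->] xy.
have [e|/negP] := hz i I j I; first by rewrite e eqxx in xy.
by rewrite -leNgt.
Qed.

Lemma measurable_admissible S (mS : measurable S) k : measurable (admissible S k).
Proof.
have mD : measurable (setT `*` S : set (k.-tuple row * row)) by exact: measurableX.
have := measurable_moving_admissible mD (@measurable_id _ _ setT).
congr measurable; apply/seteqP; split => t /= [h1 h2]; split => // i.
  by have := h1 i; rewrite /xsection/= inE => -[].
by rewrite /xsection/= inE; split => //; exact: h1.
Qed.

Lemma measurable_config_of_tuple k :
  measurable_fun setT (@config_of_tuple R d k).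
Proof.
have := @measurable_add_tuple R d _ (k.-tuple row) (cst (fset0 : config)) k id
  (@measurable_cst _ _ _ _ setT _) (@measurable_id _ _ setT).
by congr measurable_fun; apply/funext => t; rewrite fset0U.
Qed.

Lemma coef_ge0 k : 0 <= lam ^+ k / k`!%:R.
Proof. by rewrite divr_ge0// exprn_ge0. Qed.

(* Poisson weights without the factor expR (- lam |S|), which cancels in conditional laws *)
Definition gibbs_layer S (mS : measurable S) k : {measure set config -> \bar R} :=
  mscale (NngNum (coef_ge0 k))
    (image_measure (mrestr (vol k) (@measurable_admissible _ mS k))
       (@measurable_config_of_tuple k)).

Definition gibbs S (mS : measurable S) : {measure set config -> \bar R} :=
  mseries (gibbs_layer mS) 0.

Lemma gibbsE S (mS : measurable S) (E : set config) :
  gibbs mS E = (\sum_(0 <= k <oo) ((lam ^+ k / k`!%:R)%:E *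
    vol k (admissible S k `&` config_of_tuple (n:=k) @^-1` E)))%E.
Proof. by apply: eq_eseriesr => k _; rewrite /gibbs_layer/= /mscale/= /mrestr setIC. Qed.

Lemma measurable_cube S k : measurable S ->
  measurable [set t : k.-tuple row | forall i, S (tnth t i)].
Proof.
move=> mS.
rewrite (_ : [set _ | _] = \bigcap_(i in [set: 'I_k]) ((fun t => tnth t i) @^-1` S)).
  apply: fin_bigcap_measurable => // i _; rewrite -[X in measurable X]setTI.
  exact: measurable_tnth.
by apply/seteqP; split => t /= h i; [move=> _; exact: h|exact: h].
Qed.

Lemma pow_measure_cube S (s : R) k (mS : measurable S) (Ss : volume S = s%:E) :
  vol k [set t | forall i, S (tnth t i)] = (s ^+ k)%:E.
Proof.
elim: k => [|k IH] /=.
  by rewrite expr0 diracE mem_set//= => -[].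
rewrite /cons_measure /pushforward.
rewrite (_ : _ @^-1` _ = S `*` [set t | forall i, S (tnth t i)]).
  rewrite product_measure1E//; last exact: measurable_cube.
  by rewrite exprS EFinM; congr (_ * _)%E; [exact: Ss|exact: IH].
apply/seteqP; split => -[x t] /=.
  move=> h; split; first by have := h ord0; rewrite tnth0.
  by move=> i; have := h (lift ord0 i); rewrite tnthS.
move=> [xS tS] i; case: (unliftP ord0 i) => [j|] ->; last by rewrite tnth0.
by rewrite tnthS.
Qed.

Lemma exp_series (x : R) : 0 <= x ->
  (\sum_(0 <= k <oo) (x ^+ k / k`!%:R)%:E)%E = (expR x)%:E.
Proof.
move=> x0; rewrite /expR -EFin_lim; last exact: is_cvg_series_exp_coeff.
congr (limn _); apply/funext => n /=.
by rewrite /series/= sumEFin.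
Qed.

Section finite_volume.
Variables (S : set row) (mS : measurable S).
Hypothesis S_fin : (volume S < +oo)%E.

(** Dropping the hard core condition leaves the exponential series in [lam] times the volume of
    [S]. *)
Lemma gibbs_lty : (gibbs mS setT < +oo)%E.
Proof.
pose s := fine (volume S).
have Ss : volume S = s%:E by rewrite fineK// ge0_fin_numE.
rewrite gibbsE; apply: (@le_lt_trans _ _ (expR (lam * s))%:E); last exact: ltry.
rewrite -exp_series; last by rewrite mulr_ge0// /s fine_ge0.
apply: lee_nneseries => k _; first by rewrite mule_ge0// lee_fin coef_ge0.
rewrite exprMn mulrAC [X in (_ <= X)%E]EFinM; apply: lee_wpmul2l; first by rewrite lee_fin coef_ge0.
rewrite -(pow_measure_cube k mS Ss); apply: le_measure; rewrite ?inE.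
- by rewrite preimage_setT setIT; exact: measurable_admissible.
- exact: measurable_cube.
- by move=> t [[]].
Qed.

(** The empty configuration alone has weight 1. Together with finiteness, this keeps the
    normalization from falling back on its default value. *)
Lemma gibbs_ge1 : (1 <= gibbs mS setT)%E.
Proof.
rewrite gibbsE; apply: le_trans (nneseries_lim_ge 1 _); last first.
  by move=> k _ _; rewrite mule_ge0// lee_fin coef_ge0.
rewrite big_nat1 expr0 fact0 divr1 mul1e /= diracE mem_set//=.
split => //; split; first by case.
by move=> x y; rewrite in_config_of_tuple in_nil.
Qed.

Lemma gibbs_fin_num E : measurable E -> gibbs mS E \is a fin_num.
Proof.
move=> mE; rewrite ge0_fin_numE//; apply: le_lt_trans gibbs_lty.
by apply: le_measure; rewrite ?inE.
Qed.

Definition gibbs_law : probability config R :=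
  mnormalize (gibbs mS) (dirac (fset0 : config)).

Lemma gibbs_lawE E : (gibbs_law E = gibbs mS E * (fine (gibbs mS setT))^-1%:E)%E.
Proof.
rewrite /gibbs_law/= /mnormalize ifF//; apply/negbTE; rewrite negb_or.
rewrite gt_eqF/=; last by rewrite (lt_le_trans _ gibbs_ge1).
by rewrite lt_eqF//; exact: gibbs_lty.
Qed.

Lemma fine_gibbs_gt0 : 0 < fine (gibbs mS setT).
Proof.
rewrite -lte_fin fineK; last exact: gibbs_fin_num.
by rewrite (lt_le_trans _ gibbs_ge1).
Qed.

Lemma integral_gibbs_law (f : config -> \bar R) :
  measurable_fun setT f -> (forall Z, 0 <= f Z)%E ->
  (\int[gibbs_law]_Z f Z = (fine (gibbs mS setT))^-1%:E *
   \sum_(0 <= k <oo) ((lam ^+ k / k`!%:R)%:E *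
    \int[vol k]_(t in admissible S k) f (config_of_tuple t)))%E.
Proof.
move=> mf f0.
have c0 : 0 <= (fine (gibbs mS setT))^-1 by rewrite invr_ge0 ltW// fine_gibbs_gt0.
transitivity (\int[mscale (NngNum c0) (gibbs mS)]_Z f Z)%E.
  apply: eq_measure_integral => A mA _.
  exact: etrans (gibbs_lawE A) (muleC _ _).
rewrite ge0_integral_mscale//=; congr (_ * _)%E.
rewrite ge0_integral_measure_series//; apply: eq_eseriesr => k _.
rewrite /gibbs_layer ge0_integral_mscale//=; congr (_ * _)%E.
rewrite (ge0_integral_image _ (@measurable_config_of_tuple k) mf f0).
rewrite (ge0_integral_mrestr _ (@measurable_admissible _ mS k))//.
exact: (measurableT_comp mf (@measurable_config_of_tuple k)).
Qed.

(** The integral runs over admissible tuples only. This is what allows Lipschitz bounds, which are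
    known for packed configurations only, to be integrated. *)
Lemma gibbs_law_le (f g : config -> \bar R) :
  measurable_fun setT f -> measurable_fun setT g ->
  (forall Z, 0 <= f Z)%E -> (forall Z, 0 <= g Z)%E ->
  (forall Z : config, hard_core r Z -> (forall x, x \in (Z : {fset row}) -> S x) ->
    (f Z <= g Z)%E) ->
  (\int[gibbs_law]_Z f Z <= \int[gibbs_law]_Z g Z)%E.
Proof.
move=> mf mg f0 g0 fg; rewrite !integral_gibbs_law//.
apply: lee_wpmul2l; first by rewrite lee_fin invr_ge0 ltW// fine_gibbs_gt0.
have mconf := @measurable_config_of_tuple.
apply: lee_nneseries => k _.
  by rewrite mule_ge0 ?lee_fin ?coef_ge0// integral_ge0.
apply: lee_wpmul2l; first by rewrite lee_fin coef_ge0.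
apply: ge0_le_integral => //.
- exact: measurable_admissible.
- by apply: measurable_funTS; exact: (measurableT_comp mf (mconf k)).
- by apply: measurable_funTS; exact: (measurableT_comp mg (mconf k)).
- move=> t [tS ht]; apply: fg => // x; rewrite in_config_of_tuple => /tnthP[i ->].
  exact: tS.
Qed.

End finite_volume.

(** The event [H] may also carry the repulsion from frozen centers, which shrinks the allowed set
    from [S1] to [S2]. The exponential factor of the Poisson law cancels in the quotient. *)
Lemma conditional_poissonE S1 S2 (mS2 : measurable S2) (H E : set config) :
  (volume S2 < +oo)%E ->
  (forall k (t : k.-tuple row), (forall i, S1 (tnth t i)) /\ H (config_of_tuple t) <->
     admissible S2 k t) ->
  conditional_law (poisson_process lam S1) H E = gibbs_law mS2 E.
Proof.
move=> S2fin h; rewrite gibbs_lawE// /conditional_law.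
have PE F : poisson_process lam S1 (F `&` H) =
    ((expR (- (lam * fine (volume S1))))%:E * gibbs mS2 F)%E.
  rewrite /poisson_process gibbsE; congr (_ * _)%E; apply: eq_eseriesr => k _.
  congr (_ * _)%E; congr (vol k _); apply/seteqP; split => t /=.
    by move=> [a [b c]]; split => //; apply/h.
  by move=> [/h[a b] c].
rewrite PE -[H in X in (_ / X)%E]setTI PE.
set e := expR _; set z := gibbs mS2 setT.
have ez : z = (fine z)%:E by rewrite fineK//; apply: gibbs_fin_num.
have z0 : 0 < fine z by exact: fine_gibbs_gt0.
have e0 : 0 < e by exact: expR_gt0.
rewrite {1}ez -EFinM inver gt_eqF ?mulr_gt0// muleAC -EFinM.
by rewrite invfM mulrA divff ?gt_eqF// mul1r muleC.
Qed.
End gibbs.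

(** * Means of bounded functions *)

Section mean.
Context {d} {T : measurableType d} {R : realType}.
Implicit Types (P : probability T R) (f g : T -> R).

Definition mean P f : R := fine (\int[P]_x (f x)%:E).

Definition unit_function f :=
  measurable_fun [set: T] f /\ forall x, 0 <= f x <= 1.

Lemma integral_bounded P f M : measurable_fun [set: T] f ->
  (forall x, 0 <= f x <= M) -> (\int[P]_x (f x)%:E <= M%:E)%E.
Proof.
move=> mf fM; apply: (@le_trans _ _ (\int[P]_x M%:E)%E).
  apply: ge0_le_integral => //.
  - by move=> x _; rewrite lee_fin; case/andP: (fM x).
  - exact/measurable_EFinP.
  - by move=> x _; rewrite lee_fin; case/andP: (fM x).
by rewrite integral_cst//= probability_setT mule1.
Qed.

Lemma meanE P f M : measurable_fun [set: T] f -> (forall x, 0 <= f x <= M) ->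
  (mean P f)%:E = (\int[P]_x (f x)%:E)%E.
Proof.
move=> mf fM; rewrite /mean fineK// ge0_fin_numE.
  exact: le_lt_trans (integral_bounded P mf fM) (ltry _).
by apply: integral_ge0 => x _; rewrite lee_fin; case/andP: (fM x).
Qed.

Lemma mean_unit P f : unit_function f -> 0 <= mean P f <= 1.
Proof.
move=> [mf f1]; rewrite -!lee_fin (meanE P mf f1) integral_bounded// andbT.
by apply: integral_ge0 => x _; rewrite lee_fin; case/andP: (f1 x).
Qed.

(** Layer cake formula: the mean of [f] is the integral over levels [s] in [0, M] of the probability
    that [f] exceeds [s], so an error [ep] at each level integrates to [M * ep]. *)
Lemma mean_superlevel P1 P2 f M ep : measurable_fun [set: T] f ->
  (forall x, 0 <= f x <= M) -> 0 <= ep -> 0 <= M ->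
  (forall s, P1 [set x | (s < f x)%R] <= P2 [set x | (s < f x)%R] + ep%:E)%E ->
  mean P1 f <= mean P2 f + M * ep.
Proof.
move=> mf fM ep0 M0 h.
pose f' : {mfun T >-> R} := HB.pack f (isMeasurableFun.Build _ _ _ _ _ mf).
have layer P : (\int[P]_x (f x)%:E =
    \int[lebesgue_measure]_(s in `[0%R, M]) @ccdf _ T R P f' s)%E.
  have f0 x : 0 <= f' x by case/andP: (fM x).
  have := @ge0_expectation_ccdf _ T R P f' f0.
  rewrite expectation_def => ->.
  rewrite integral_mkcond [RHS]integral_mkcond; apply: eq_integral => s _.
  rewrite !patchE !mem_setE !in_itv/= andbT.
  have [s0|] //= := boolP (0 <= s); have [//|sM] := boolP (s <= M).
  rewrite /ccdf /distribution /= /pushforward (_ : _ @^-1` _ = set0) ?measure0//.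
  rewrite -subset0 => x /=; rewrite in_itv/= andbT => sf.
  move: sM; rewrite -ltNge => /ltW Ms; move: sf.
  by rewrite ltNge (le_trans _ Ms)//; case/andP: (fM x).
have mc P : measurable_fun `[0%R, M] (@ccdf _ T R P f').
  by apply: measurable_funTS; exact: ccdf_measurable.
have ccdf0 P s : (0 <= @ccdf _ T R P f' s)%E by exact: measure_ge0.
rewrite -lee_fin EFinD (meanE P1 mf fM) (meanE P2 mf fM) !layer.
have -> : ((M * ep)%:E = \int[lebesgue_measure]_(s in `[0%R, M]) ep%:E)%E.
  rewrite integral_cst//= lebesgue_measure_itv/= lte_fin.
  rewrite muleC EFinM; case: ifPn => [_|]; first by rewrite oppr0 addr0.
  by rewrite -leNgt => M0'; rewrite (_ : M = 0) ?mul0e//; apply/eqP; rewrite eq_le M0 M0'.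
rewrite -ge0_integralD//=; last exact: mc.
apply: ge0_le_integral => //.
- exact: mc.
- by apply: emeasurable_funD => //; exact: mc.
- move=> s _; have := h s; congr (_ <= _ + _)%E.
    by rewrite /ccdf /distribution /= /pushforward; congr (P1 _);
      apply/seteqP; split => x /=; rewrite in_itv/= andbT.
  by rewrite /ccdf /distribution /= /pushforward; congr (P2 _);
      apply/seteqP; split => x /=; rewrite in_itv/= andbT.
Qed.

End mean.

(** * Functions of configurations and their one-point Lipschitz constants *)

Section lipschitz.
Context {R : realType} {d : nat} (r : R).
Local Notation row := 'rV[R]_d.
Local Notation config := (@config R d).
Implicit Types (S A B : set row) (X Y Z W : {fset row}) (f g : config -> R).

(* configurations A tau is packed r (centers r A `\` tau) *)
Definition packed S X := hard_core r X /\ forall x, x \in X -> S x.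

(** Only packed configurations are constrained: these are the states of the chain, and deleting
    points keeps them packed. *)
Definition point_lipschitz S (c : R) f := forall X v,
  v \notin X -> packed S (v |` X)%fset -> `|f (v |` X)%fset - f X| <= c.

Lemma packed_sub S X Y : {subset X <= Y} -> packed S Y -> packed S X.
Proof.
move=> XY [hY SY]; split => [x y xX yX|x xX]; last exact/SY/XY.
by apply: hY; exact: XY.
Qed.

Lemma packedS S S' X : S `<=` S' -> packed S X -> packed S' X.
Proof. by move=> SS' [hX SX]; split => // x /SX/SS'. Qed.

(** The points of [W] are added one at a time. The intermediate configurations are subsets of the
    last one, hence packed, and a point already in [X] changes nothing. *)
Lemma lipschitz_fsetU S c f X W : 0 <= c -> point_lipschitz S c f ->
  packed S (X `|` W)%fset -> `|f (X `|` W)%fset - f X| <= c * (#|` W|)%:R.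
Proof.
move=> c0 lf; move: {2}#|` W| (erefl #|` W|) => n; elim: n W => [|n IH] W Wn XW.
  have -> : W = fset0 by apply: cardfs0_eq.
  by rewrite fsetU0 subrr normr0 cardfs0 mulr0.
have /fset0Pn[x xW] : W != fset0 by rewrite -cardfs_gt0 Wn.
pose V := (W `\ x)%fset.
have WE : W = (x |` V)%fset by rewrite /V fsetD1K.
have Vn : #|` V| = n by move: Wn; rewrite (cardfsD1 x) xW add1n => -[].
have XWE : (X `|` W)%fset = (x |` (X `|` V))%fset by rewrite WE fsetUCA.
have XV : packed S (X `|` V)%fset.
  by apply: packed_sub XW => y yXV; rewrite XWE in_fset1U yXV orbT.
rewrite Wn -natr1 mulrDr mulr1 -Vn; apply: le_trans (lerD (IH _ Vn XV) _).
  rewrite -(subrK (f (X `|` V)%fset) (f (X `|` W)%fset)) -addrA addrC.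
  exact: ler_normD.
rewrite XWE; have [xXV|xXV] := boolP (x \in (X `|` V)%fset).
  rewrite (_ : (x |` _)%fset = (X `|` V)%fset) ?subrr ?normr0//.
  by apply/fsetP => y; rewrite in_fset1U; case: eqP => // ->; rewrite xXV.
by apply: lf => //; rewrite -XWE.
Qed.

Lemma lipschitz_sub S c f X Y : 0 <= c -> point_lipschitz S c f ->
  (X `<=` Y)%fset -> packed S Y -> `|f Y - f X| <= c * (#|` (Y `\` X)%fset|)%:R.
Proof.
move=> c0 lf XY pY; have YE : Y = (X `|` (Y `\` X))%fset.
  by rewrite fsetUDl fsetDv fsetD0; apply/esym/fsetUidPr.
by rewrite [in f Y]YE; apply: (lipschitz_fsetU c0 lf); rewrite -YE.
Qed.

End lipschitz.

(** * Comparison of means under hard sphere laws *)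

Section gibbs_mean.
Context {R : realType} {d : nat} (r lam : R) (lam_ge0 : 0 <= lam).
Local Notation row := 'rV[R]_d.
Local Notation config := (@config R d).
Implicit Types (S A B : set row) (X Y W : {fset row}) (Z : config) (f g : config -> R).

(** The constants [a] and [b] are added on both sides so that all integrands stay nonnegative and no
    extended integrals are subtracted. *)
Lemma gibbs_mean_le S (mS : measurable S) f g M N a b : (volume S < +oo)%E ->
  measurable_fun setT f -> measurable_fun setT g ->
  (forall Z, 0 <= f Z <= M) -> (forall Z, 0 <= g Z <= N) -> 0 <= a -> 0 <= b ->
  (forall Z, packed r S Z -> f Z + a <= g Z + b) ->
  mean (gibbs_law r lam_ge0 mS) f + a <= mean (gibbs_law r lam_ge0 mS) g + b.
Proof.
move=> Sfin mf mg fM gN a0 b0 fg; set P := gibbs_law _ _ _.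
have shift (h : config -> R) H e : measurable_fun setT h -> (forall Z, 0 <= h Z <= H) -> 0 <= e ->
    (mean P h + e)%:E = (\int[P]_Z ((h Z)%:E + e%:E))%E.
  move=> mh hH e0; rewrite EFinD (meanE P mh hH).
  rewrite ge0_integralD//=.
  - by rewrite integral_cst//= probability_setT mule1.
  - by move=> x _; rewrite lee_fin; case/andP: (hH x).
  - exact/measurable_EFinP.
rewrite -lee_fin (shift _ _ _ mf fM)// (shift _ _ _ mg gN)//.
apply: gibbs_law_le => //.
- by apply: emeasurable_funD => //; exact/measurable_EFinP.
- by apply: emeasurable_funD => //; exact/measurable_EFinP.
- by move=> Z; rewrite -EFinD lee_fin addr_ge0//; case/andP: (fM Z).
- by move=> Z; rewrite -EFinD lee_fin addr_ge0//; case/andP: (gN Z).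
- by move=> Z hZ SZ; rewrite -!EFinD lee_fin; apply: fg.
Qed.

Lemma gibbs_mean_close S (mS : measurable S) f g dl : (volume S < +oo)%E ->
  unit_function f -> unit_function g -> 0 <= dl ->
  (forall Z, packed r S Z -> `|f Z - g Z| <= dl) ->
  `|mean (gibbs_law r lam_ge0 mS) f - mean (gibbs_law r lam_ge0 mS) g| <= dl.
Proof.
move=> Sfin [mf f1] [mg g1] dl0 fg.
have := gibbs_mean_le mS Sfin mf mg f1 g1 (lexx 0) dl0.
have := gibbs_mean_le mS Sfin mg mf g1 f1 (lexx 0) dl0.
rewrite !addr0 => h1 h2; rewrite ler_distl lerBlDr; apply/andP; split.
  by apply: h1 => Z /fg; rewrite ler_distl addr0 lerBlDr => /andP[].
by apply: h2 => Z /fg; rewrite ler_distl addr0 => /andP[].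
Qed.

Lemma chain_close (p1 p2 q1 q2 l k1 k2 : R) :
  p1 <= q1 + (l + k1) -> q1 + l <= p1 + k1 ->
  p2 <= q2 + (l + k1) -> q2 + l <= p2 + k1 -> q1 <= q2 + k2 -> q2 <= q1 + k2 ->
  `|p2 - p1| <= 2 * k1 + k2.
Proof. by move=> *; rewrite ler_distl; apply/andP; split; lra. Qed.

(* The points outside of F are paid for by their number, and those of F by the
   total variation distance of the two laws seen through F. *)
Lemma gibbs_mean_influence S0 S1 S2 (mS1 : measurable S1) (mS2 : measurable S2)
    (F : set row) X' f (c m1 m2 ep : R) :
  (volume S1 < +oo)%E -> (volume S2 < +oo)%E -> S2 `<=` S1 -> measurable F ->
  0 <= c -> 0 <= m2 -> 0 <= ep -> unit_function f -> point_lipschitz r S0 c f ->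
  (forall Z, packed r S1 Z -> packed r S0 (X' `|` Z)%fset) ->
  (forall Z, packed r S1 Z -> (#|` restriction (~` F) Z|)%:R <= m1) ->
  (forall Z, packed r S1 Z -> (#|` Z|)%:R <= m2) ->
  (forall E : set config, measurable E ->
    (`|gibbs_law r lam_ge0 mS1 ((restriction F : config -> config) @^-1` E) -
       gibbs_law r lam_ge0 mS2 ((restriction F : config -> config) @^-1` E)| <= ep%:E)%E) ->
  measurable_fun setT (fun Z : config => f (X' `|` Z)%fset) ->
  `|mean (gibbs_law r lam_ge0 mS2) (fun Z => f (X' `|` Z)%fset) -
    mean (gibbs_law r lam_ge0 mS1) (fun Z => f (X' `|` Z)%fset)| <=
  c * (2 * m1 + 2 * m2 * ep).
Proof.
move=> S1fin S2fin S21 mF c0 m20 ep0 [mf f1] lf S01 near far tv mfX.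
(* For packed [Z] the value lies within [c * m2] of [f X']. Clamping between [lo] and [hi] forces a
   range of width at most [2 * c * m2] on all configurations, as the layer cake formula requires.
   The maximum with 0 makes [lo] usable as a shift in [gibbs_mean_le]. *)
pose lo := Num.max 0 (f X' - c * m2); pose hi := f X' + c * m2.
pose h (Z : config) := Num.max lo (Num.min hi (f (X' `|` Z)%fset)) - lo.
(* The function [g] sees only the points in [F], so its superlevel sets are events of the
   projection, to which the bound [ep] applies. *)
pose g (Z : config) := h (restriction F Z).
have cm2 : 0 <= c * m2 by rewrite mulr_ge0.
have [fX0 fX1] : 0 <= f X' /\ f X' <= 1 by apply/andP.
have lo0 : 0 <= lo by rewrite /lo le_max lexx.
have width : hi - lo <= 2 * c * m2.
  have : f X' - c * m2 <= lo by rewrite /lo le_max lexx orbT.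
  by rewrite /hi; lra.
have mrF : measurable_fun setT (restriction F : config -> config).
  have mD : measurable (setT `*` F : set (config * row)) by exact: measurableX.
  have := measurable_moving_restriction (@measurable_id _ config setT) mD.
  congr measurable_fun; apply/funext => Z; apply/fsetP => x.
  rewrite !in_restriction; congr andb; apply/idP/idP; rewrite /xsection !inE/= ?inE.
    by case.
  by move=> ?; split.
have mh : measurable_fun setT h.
  by apply: measurable_funB => //; apply: measurable_maxr => //; exact: measurable_minr.
have mg : measurable_fun setT g by exact: (measurableT_comp mh mrF).
have h_range Z : 0 <= h Z <= 2 * c * m2.
  rewrite /h subr_ge0 le_max lexx/= lerBlDr ge_max; apply/andP; split.
    by rewrite lerDr -mulrA mulr_ge0.
  by rewrite ge_min; apply/orP; left; rewrite -lerBlDr.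
have hE Z : packed r S1 Z -> h Z = f (X' `|` Z)%fset - lo.
  move=> pZ; rewrite /h; have := lipschitz_fsetU c0 lf (S01 Z pZ).
  have : c * (#|` Z|)%:R <= c * m2 by apply: ler_wpM2l => //; exact: far.
  move=> b1 /le_trans/(_ b1); rewrite ler_distl => /andP[b2 b3].
  congr (_ - _); rewrite min_r// max_r// /lo ge_max b2 andbT.
  by case/andP: (f1 (X' `|` Z)%fset).
have gE Z : packed r S1 Z -> `|f (X' `|` Z)%fset - (g Z + lo)| <= c * m1.
  move=> pZ; have pF : packed r S1 (restriction F Z).
    by apply: packed_sub pZ => x; rewrite in_restriction => /andP[].
  rewrite /g (hE _ pF) subrK.
  have ZE : (X' `|` Z)%fset = ((X' `|` restriction F Z) `|` restriction (~` F) Z)%fset.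
    rewrite -fsetUA; congr (_ `|` _)%fset; apply/fsetP => x.
    rewrite in_fsetU !in_restriction in_setC.
    by case: (x \in Z); case: (x \in F).
  rewrite [in f (X' `|` Z)%fset]ZE; apply: le_trans (lipschitz_fsetU c0 lf _) _.
    by rewrite -ZE; exact: S01.
  by apply: ler_wpM2l => //; exact: near.
have m10 : 0 <= c * m1.
  have p0 : packed r S1 (fset0 : {fset row}).
    by split => [x y|x]; rewrite (in_fset0 x).
  by rewrite mulr_ge0//; apply: le_trans (near _ p0).
have g_range Z : 0 <= g Z <= 2 * c * m2 by exact: h_range.
have fX_range Z : 0 <= f (X' `|` Z)%fset <= 1 by exact: f1.
have lm0 : 0 <= lo + c * m1 by rewrite addr_ge0.
(* Forgetting the points outside [F] costs [c * m1] under either law, as both allowed sets lie in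
   [S1]. *)
have cf (S : set row) (mS : measurable S) : (volume S < +oo)%E -> S `<=` S1 ->
    mean (gibbs_law r lam_ge0 mS) (fun Z => f (X' `|` Z)%fset) <=
      mean (gibbs_law r lam_ge0 mS) g + (lo + c * m1) /\
    mean (gibbs_law r lam_ge0 mS) g + lo <=
      mean (gibbs_law r lam_ge0 mS) (fun Z => f (X' `|` Z)%fset) + c * m1.
  move=> Sfin SS1; split.
    rewrite -[leLHS]addr0.
    apply: (gibbs_mean_le mS Sfin mfX mg fX_range g_range (lexx 0) lm0).
    by move=> Z /(packedS SS1)/gE; rewrite ler_distl addr0 addrA => /andP[].
  apply: (gibbs_mean_le mS Sfin mg mfX g_range fX_range lo0 m10) => Z /(packedS SS1)/gE.
  by rewrite ler_distl lerBlDr => /andP[].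
have [a1 a2] := cf _ mS1 S1fin (@subset_refl _ _).
have [b1 b2] := cf _ mS2 S2fin S21.
have level s : measurable [set Z : config | s < h Z].
  have := mh measurableT _ (measurable_itv `]s, +oo[); rewrite setTI.
  by congr measurable; apply/seteqP; split => Z /=; rewrite in_itv/= andbT.
have fnum (S : set row) (mS : measurable S) E : measurable E ->
    gibbs_law r lam_ge0 mS E \is a fin_num by move=> mE; exact: fin_num_measure.
have mpre E : measurable E -> measurable ((restriction F : config -> config) @^-1` E).
  by move=> mE; rewrite -[X in measurable X]setTI; exact: mrF.
have cm2' : 0 <= 2 * c * m2 by rewrite -mulrA mulr_ge0.
have t12 : mean (gibbs_law r lam_ge0 mS1) g <=
    mean (gibbs_law r lam_ge0 mS2) g + 2 * c * m2 * ep.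
  apply: mean_superlevel => // s; have mE := level s; have := tv _ mE.
  have n1 := fnum _ mS1 _ (mpre _ mE); have n2 := fnum _ mS2 _ (mpre _ mE).
  rewrite -(fineK n1) -(fineK n2) -EFinB /= lee_fin ler_distl => /andP[_ e1].
  suff : (gibbs_law r lam_ge0 mS1
        ((restriction F : config -> config) @^-1` [set Z | (s < h Z)%R]) <=
      gibbs_law r lam_ge0 mS2
        ((restriction F : config -> config) @^-1` [set Z | (s < h Z)%R]) + ep%:E)%E by [].
  by rewrite -(fineK n1) -(fineK n2) -EFinD lee_fin.
have t21 : mean (gibbs_law r lam_ge0 mS2) g <=
    mean (gibbs_law r lam_ge0 mS1) g + 2 * c * m2 * ep.
  apply: mean_superlevel => // s; have mE := level s; have := tv _ mE.
  have n1 := fnum _ mS1 _ (mpre _ mE); have n2 := fnum _ mS2 _ (mpre _ mE).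
  rewrite -(fineK n1) -(fineK n2) -EFinB /= lee_fin ler_distl lerBlDr => /andP[e1 _].
  suff : (gibbs_law r lam_ge0 mS2
        ((restriction F : config -> config) @^-1` [set Z | (s < h Z)%R]) <=
      gibbs_law r lam_ge0 mS1
        ((restriction F : config -> config) @^-1` [set Z | (s < h Z)%R]) + ep%:E)%E by [].
  by rewrite -(fineK n1) -(fineK n2) -EFinD lee_fin.
have -> : c * (2 * m1 + 2 * m2 * ep) = 2 * (c * m1) + 2 * c * m2 * ep by ring.
exact: chain_close a1 a2 b1 b2 t12 t21.
Qed.

End gibbs_mean.

(** * One update in the presence of one disagreement *)

Section influence.
Context {R : realType} {d : nat} (r lam : R) (r_gt0 : 0 < r) (lam_ge0 : 0 <= lam)
  (ball_volume : volume (euclidean_ball (0 : 'rV[R]_d) r) = 1%E).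
Local Notation row := 'rV[R]_d.
Local Notation config := (@config R d).
Implicit Types (S A B tau : set row) (X Y : {fset row}) (Z : config) (x v : row)
  (f : config -> R) (L K c : R).

Lemma measurable_fsetUl X : measurable_fun setT ((fun Z => X `|` Z)%fset : config -> config).
Proof.
have := measurable_add_tuple (@measurable_id _ config setT)
  (@measurable_cst _ _ config _ setT (in_tuple (X : seq row))).
congr measurable_fun; apply/funext => Z; apply/fsetP => x.
by rewrite !in_fsetU in_config_of_tuple orbC.
Qed.

Definition outside x L X : {fset row} := restriction (~` euclidean_ball x L) X.

Definition free_region S x L X : set row :=
  [set y | [/\ S y, euclidean_dist x y < L &
    forall w, w \in outside x L X -> 2 * r <= euclidean_dist w y]].

Lemma in_outside x L X w : (w \in outside x L X) = (w \in X) && (L <= euclidean_dist x w).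
Proof.
rewrite in_restriction in_setC; congr andb; rewrite leNgt; congr negb.
by apply/idP/idP; rewrite inE.
Qed.

Lemma measurable_free_region S x L X : measurable S -> measurable (free_region S x L X).
Proof.
move=> mS.
rewrite (_ : free_region S x L X = S `&` euclidean_ball x L `&`
  \bigcap_(w in [set` outside x L X]) ~` euclidean_ball w (2 * r)).
  apply: measurableI; first by apply: measurableI => //; exact: measurable_eball.
  apply: fin_bigcap_measurable; first exact: finite_fset.
  by move=> w _; apply: measurableC; exact: measurable_eball.
apply/seteqP; split => y /=.
  by move=> [Sy xy h]; split => // w /h; rewrite leNgt => /negP.
by move=> [[Sy xy] h]; split => // w /h; rewrite leNgt => /negP.
Qed.

Lemma free_region_sub S x L X : free_region S x L X `<=` S.
Proof. by move=> y []. Qed.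

Lemma free_region_lty S x L X : measurable S -> (volume S < +oo)%E ->
  (volume (free_region S x L X) < +oo)%E.
Proof.
move=> mS; apply: le_lt_trans; apply: le_measure; rewrite ?inE//.
- exact: measurable_free_region.
- exact: free_region_sub.
Qed.

Lemma outside_sub x L X : {subset outside x L X <= X}.
Proof. by move=> w; rewrite in_outside => /andP[]. Qed.

Lemma packed_update S x L X Z : packed r S X -> packed r (free_region S x L X) Z ->
  packed r S (outside x L X `|` Z)%fset.
Proof.
move=> [hX SX] [hZ SZ]; split => [y z|y].
  rewrite !in_fsetU => /orP[yX|yZ] /orP[zX|zZ] yz.
  - exact: hX (outside_sub yX) (outside_sub zX) yz.
  - by have [_ _] := SZ _ zZ; exact.
  - by rewrite edistC; have [_ _] := SZ _ yZ; exact.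
  - exact: hZ.
by rewrite in_fsetU => /orP[/outside_sub/SX//|/SZ[]].
Qed.

Definition block_law S (mS : measurable S) x L X : probability config R :=
  gibbs_law r lam_ge0 (measurable_free_region x L X mS).

Definition block_mean S (mS : measurable S) x L f X : R :=
  mean (block_law mS x L X) (fun Z => f (outside x L X `|` Z)%fset).

Lemma unit_update f Y : unit_function f ->
  unit_function (fun Z => f (Y `|` Z)%fset).
Proof.
by move=> [mf f1]; split => // ; exact: (measurableT_comp mf (measurable_fsetUl Y)).
Qed.

Lemma gibbs_mean_eq S1 S2 (mS1 : measurable S1) (mS2 : measurable S2) f : S1 = S2 ->
  mean (gibbs_law r lam_ge0 mS1) f = mean (gibbs_law r lam_ge0 mS2) f.
Proof. by move=> SS; subst S2; rewrite (Prop_irrelevance mS1 mS2). Qed.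

Section one_disagreement.
Variables (S : set row) (mS : measurable S) (S_fin : (volume S < +oo)%E).
Variables (f : config -> R) (c : R) (x v : row) (L : R) (X : {fset row}).
Hypotheses (f_unit : unit_function f) (c_ge0 : 0 <= c) (f_lip : point_lipschitz r S c f).
Hypotheses (vX : v \notin X) (pX : packed r S (v |` X)%fset).

Lemma outside_inner : euclidean_dist x v < L -> outside x L (v |` X)%fset = outside x L X.
Proof.
move=> xv; apply/fsetP => w; rewrite !in_outside in_fset1U.
by case: eqP => //= ->; rewrite leNgt xv/= andbF.
Qed.

Lemma outside_outer : L <= euclidean_dist x v ->
  outside x L (v |` X)%fset = (v |` outside x L X)%fset.
Proof.
move=> xv; apply/fsetP => w; rewrite in_fset1U !in_outside in_fset1U.
by case: eqP => //= ->; rewrite xv.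
Qed.

Lemma block_mean_inner : euclidean_dist x v < L ->
  block_mean mS x L f (v |` X)%fset = block_mean mS x L f X.
Proof.
move=> xv; rewrite /block_mean (outside_inner xv); apply: gibbs_mean_eq.
by rewrite /free_region (outside_inner xv).
Qed.

(** First half of the comparison when [v] stays frozen: the law is kept and only the argument of [f]
    loses [v], which costs one Lipschitz step. *)
Lemma block_mean_shift : L <= euclidean_dist x v ->
  `|block_mean mS x L f (v |` X)%fset -
    mean (block_law mS x L (v |` X)%fset) (fun Z => f (outside x L X `|` Z)%fset)| <= c.
Proof.
move=> xv; apply: gibbs_mean_close => //.
- exact: free_region_lty.
- exact: unit_update.
- exact: unit_update.
move=> Z pZ; have := packed_update pX pZ; rewrite (outside_outer xv) -fsetUA => pU.
have [vZ|vZ] := boolP (v \in (outside x L X `|` Z)%fset); last exact: f_lip.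
rewrite (_ : (v |` _)%fset = (outside x L X `|` Z)%fset) ?subrr ?normr0//.
by apply/fsetP => y; rewrite in_fset1U; case: eqP => // ->; rewrite vZ.
Qed.

Lemma block_mean_outer : L + 2 * r <= euclidean_dist x v ->
  `|block_mean mS x L f (v |` X)%fset - block_mean mS x L f X| <= c.
Proof.
move=> xv; have Lxv : L <= euclidean_dist x v.
  by rewrite (le_trans _ xv)// lerDl mulr_ge0// ltW.
rewrite {2}/block_mean (_ : mean (block_law mS x L X) _ =
  mean (block_law mS x L (v |` X)%fset) (fun Z => f (outside x L X `|` Z)%fset)).
  exact: block_mean_shift.
(* The exclusion ball of [v] misses the update ball, so both free regions coincide. *)
apply: gibbs_mean_eq; rewrite /free_region (outside_outer Lxv).
apply/seteqP; split => y /= [Sy xy h]; split => // w.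
  rewrite in_fset1U => /orP[/eqP ->|/h//].
  rewrite -(lerD2l L) (le_trans xv)// (le_trans (edist_triangle y _ _))//.
  by rewrite (edistC y) lerD2r ltW.
by move=> wX; apply: h; rewrite in_fset1U wX orbT.
Qed.

End one_disagreement.

(* Every set S of allowed centers is reached by a boundary condition on A itself,
   so strong spatial mixing is applied on A also for the laws in a block. *)
Lemma hard_sphere_modelE A S (mS : measurable S) E : measurable A ->
  (volume S < +oo)%E -> S `<=` centers r A ->
  hard_sphere_model r lam A (centers r A `\` S) E = gibbs_law r lam_ge0 mS E.
Proof.
move=> mA Sfin SA; apply: conditional_poissonE => // k t.
rewrite (_ : centers r A `\` (centers r A `\` S) = S)//.
by rewrite setDD setIidr.
Qed.

Section annulus.
Variables (alpha beta : R).
Hypotheses (alpha_gt0 : 0 < alpha) (beta_gt0 : 0 < beta).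
Hypothesis ssm : forall A' A, region A' -> region A -> A' `<=` A ->
  forall tau tau', boundary_condition r A tau -> boundary_condition r A tau' ->
  (local_total_variation r A' (hard_sphere_model r lam A tau) (hard_sphere_model r lam A tau') <=
   beta%:E * volume A' * expeR (- (alpha%:E * set_dist (tau `+` tau') A')))%E.

(** The bound of strong spatial mixing at distance [K], for a window contained in a ball of radius
    [L + 2 * r]. *)
Definition mixing_error L K : R :=
  beta * ((L + 2 * r) / r) ^+ d * expR (- (alpha * K)).

(* Powers of radii divided by r are the packing bounds for balls of these radii. *)
Definition influence_bound L K : R :=
  2 * ((K + 3 * r + r) / r) ^+ d + 2 * ((L + r) / r) ^+ d * mixing_error L K.

(** The two boundary conditions differ only on [S1] minus [S2], which lies within [2 * r] of [v],
    while the window keeps distance [K + 2 * r] from [v]; so the distance in the mixing bound is at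
    least [K]. *)
Lemma gibbs_spatial_mixing A S1 S2 (mS1 : measurable S1) (mS2 : measurable S2) x v L K E :
  region A -> S1 `<=` centers r A -> (volume S1 < +oo)%E -> S2 `<=` S1 ->
  (forall y, S1 y -> ~ S2 y -> euclidean_dist v y < 2 * r) -> 0 < L -> 0 < K ->
  let F := centers r (A `&` closed_eball x (L + r) `\` euclidean_ball v (K + 2 * r)) in
  measurable E ->
  (`|gibbs_law r lam_ge0 mS1 ((restriction F : config -> config) @^-1` E) -
     gibbs_law r lam_ge0 mS2 ((restriction F : config -> config) @^-1` E)| <=
   (mixing_error L K)%:E)%E.
Proof.
move=> [cA mA] S1A S1fin S21 Sv L0 K0 F mE.
set A' := (X in centers r X) in F *.
have S2fin : (volume S2 < +oo)%E.
  by apply: le_lt_trans S1fin; apply: le_measure; rewrite ?inE.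
have mA' : measurable A'.
  apply: measurableD; last exact: measurable_eball.
  by apply: measurableI => //; exact: measurable_closed_eball.
have rA' : region A'.
  split => //; rewrite /A' setDE -setIA; apply: compact_closedI => //.
  apply: closedI; first exact: closed_closed_eball.
  by apply: open_closedC; exact: open_eball.
have A'A : A' `<=` A by move=> y [[]].
have mC : measurable (centers r A) by exact: measurable_centers.
have bc S (mS : measurable S) : S `<=` centers r A -> boundary_condition r A (centers r A `\` S).
  by move=> SA; split; [exact: measurableD|exact: subDsetl].
have sm := ssm rA' (conj cA mA) A'A (bc _ mS1 S1A) (bc _ mS2 (subset_trans S21 S1A)).
apply: (le_trans _ (le_trans sm _)).
  apply: ereal_sup_ubound => /=; exists E => //.
  by rewrite /pushforward !hard_sphere_modelE//; exact: subset_trans S21 S1A.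
(* The closed ball of radius [L + r] is enlarged to an open ball, whose volume is known. *)
have volA' : (volume A' <= (((L + 2 * r) / r) ^+ d)%:E)%E.
  have l0 : 0 < L + 2 * r by rewrite addr_gt0// mulr_gt0.
  rewrite -(volume_eball r_gt0 ball_volume x l0); apply: le_measure; rewrite ?inE//.
    exact: measurable_eball.
  move=> y [[_ xy] _]; apply: le_lt_trans xy _.
  by rewrite ltrD2l mulr_natl mulr2n ltrDl.
have dist_K : (K%:E <= set_dist ((centers r A `\` S1) `+` (centers r A `\` S2)) A')%E.
  apply: set_dist_ge => y z yS [_ zv]; rewrite lee_fin.
  have yv : euclidean_dist v y < 2 * r.
    case: yS => -[[Cy n1] n2]; last by apply: Sv => //; apply: contrapT => nS1; exact: n2.
    by exfalso; apply: n1; apply: S21; apply: contrapT => nS2; exact: n2.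
  move/negP: zv; rewrite -leNgt => zv; rewrite -(lerD2r (2 * r)) (le_trans zv)//.
  by rewrite (le_trans (edist_triangle y _ _))// addrC lerD2l ltW.
rewrite /mixing_error EFinM EFinM; apply: lee_pmul => //.
- by rewrite mule_ge0// lee_fin ltW.
- exact: expeR_ge0.
- by apply: lee_wpmul2l => //; rewrite lee_fin ltW.
- rewrite (_ : (expR _)%:E = expeR (- (alpha * K))%:E)// lee_expeR EFinN leeN2 EFinM.
  by apply: lee_wpmul2l => //; rewrite lee_fin ltW.
Qed.
(** The projection keeps only centers at depth [r] in the window. The window is therefore padded by
    [r] on both sides: its outer radius is [L + r] instead of [L], its inner radius [K + 2 * r]
    instead of [K + 3 * r]. *)
Lemma far_center A x v L K y : centers r A y -> euclidean_dist x y < L ->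
  K + 3 * r <= euclidean_dist v y ->
  centers r (A `&` closed_eball x (L + r) `\` euclidean_ball v (K + 2 * r)) y.
Proof.
move=> /centersP[Ay hA] xy vy; apply/centersP; split.
  split; first by split => //; rewrite /closed_eball/= (le_trans (ltW xy))// lerDl ltW.
  apply/negP; rewrite -leNgt (le_trans _ vy)// lerD2l ler_wpM2r ?ler_nat//.
  exact: ltW.
move=> z nz; have [Az|] := pselect (A z); last exact: hA.
have [xz|xz] := leP (euclidean_dist x z) (L + r).
  have vz : euclidean_dist v z < K + 2 * r by apply: contrapT => vz; exact: nz.
  rewrite edistC -(lerD2l (K + 2 * r)) (_ : K + 2 * r + r = K + 3 * r); last by ring.
  by rewrite (le_trans vy)// (le_trans (edist_triangle z _ _))// lerD2r ltW.
rewrite -(lerD2l L) (le_trans (ltW xz))// (le_trans (edist_triangle y _ _))//.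
by rewrite lerD2r ltW.
Qed.

(** The summand 1 pays for [v] itself, which stays frozen; the influence bound pays for the change
    of the law in the block, whose free region shrinks near [v]. *)
Lemma block_mean_annulus A S (mS : measurable S) f c x v L K X :
  region A -> S `<=` centers r A -> (volume S < +oo)%E ->
  unit_function f -> 0 <= c -> point_lipschitz r S c f ->
  v \notin X -> packed r S (v |` X)%fset -> 0 < L -> 0 < K ->
  L <= euclidean_dist x v ->
  `|block_mean mS x L f (v |` X)%fset - block_mean mS x L f X| <=
  c * (1 + influence_bound L K).
Proof.
move=> rA SA Sfin uf c0 lf vX pX L0 K0 xv.
have mA : measurable A by case: rA.
have pX' : packed r S X by apply: packed_sub pX => y yX; rewrite in_fset1U yX orbT.
pose mid := mean (block_law mS x L (v |` X)%fset) (fun Z => f (outside x L X `|` Z)%fset).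
rewrite -(subrK mid (block_mean mS x L f (v |` X)%fset)) -addrA.
rewrite (le_trans (ler_normD _ _))// mulrDr mulr1; apply: lerD.
  exact: block_mean_shift.
pose A' := A `&` closed_eball x (L + r) `\` euclidean_ball v (K + 2 * r).
have mA' : measurable A'.
  apply: measurableD; last exact: measurable_eball.
  by apply: measurableI => //; exact: measurable_closed_eball.
have S1fin Y : (volume (free_region S x L Y) < +oo)%E by exact: free_region_lty.
have S21 : free_region S x L (v |` X)%fset `<=` free_region S x L X.
  move=> y [Sy xy h]; split => // w wX; apply: h.
  by rewrite (outside_outer _ xv) in_fset1U wX orbT.
have mF := measurable_centers r mA'.
apply: (@gibbs_mean_influence R d r lam lam_ge0 S _ _ (measurable_free_region x L X mS)
  (measurable_free_region x L (v |` X)%fset mS) _ _ _ _ _ _ _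
  (S1fin X) (S1fin _) S21 mF c0 _ _ uf lf) => //.
- by rewrite exprn_ge0// divr_ge0// ?ltW// addr_gt0.
- rewrite /mixing_error !mulr_ge0 ?expR_ge0 ?(ltW beta_gt0)// exprn_ge0// divr_ge0 ?(ltW r_gt0)//.
  by rewrite addr_ge0 ?ltW// mulr_gt0.
- by move=> Z; exact: packed_update.
(* A center missed by the window lies within [K + 3 * r] of [v], so packing bounds the number of
   such centers. *)
- move=> Z [hZ SZ]; apply: (packing_ball r_gt0 ball_volume (v := v)).
  + by rewrite addr_gt0// mulr_gt0.
  + by move=> y z; rewrite !in_restriction => /andP[yZ _] /andP[zZ _]; exact: hZ.
  + move=> y; rewrite in_restriction in_setC => /andP[yZ /negP yF].
    have [Sy xy _] := SZ _ yZ.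
    rewrite ltNge; apply/negP => vy; apply: yF; rewrite inE.
    by apply: far_center => //; exact: SA.
- move=> Z [hZ SZ]; apply: (packing_ball r_gt0 ball_volume (v := x)) => // y yZ.
  by have [] := SZ _ yZ.
- move=> E mE; apply: gibbs_spatial_mixing => //.
  + by apply: subset_trans SA; exact: free_region_sub.
  + move=> y [Sy xy h] n2; rewrite ltNge; apply/negP => vy; apply: n2; split => // w.
    by rewrite (outside_outer _ xv) in_fset1U => /orP[/eqP ->//|]; exact: h.
- by case: (unit_update (outside x L X) uf).
Qed.

End annulus.
End influence.

(** * The heat-bath operator *)

Section mixture.
(* integral_kcomp is stated for parametrized kernels: the parameter is tt. *)
Context d1 d2 (Y : measurableType d1) (Z : measurableType d2) (R : realType).
Variables (m : probability Y R) (k : Y -> {measure set Z -> \bar R}).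
Hypothesis mk : forall U, measurable U -> measurable_fun [set: Y] (k ^~ U).
Hypothesis k1 : forall y, k y [set: Z] = 1%E.

Definition constant_kernel (_ : unit) : {measure set Y -> \bar R} := m.

Let measurable_constant_kernel U : measurable U ->
  measurable_fun [set: unit] (constant_kernel ^~ U).
Proof. by move=> mU; exact: measurable_cst. Qed.

HB.instance Definition _ := isKernel.Build _ _ _ _ _ constant_kernel
  measurable_constant_kernel.

Let constant_kernel_prob x : constant_kernel x [set: Y] = 1%E.
Proof. exact: probability_setT. Qed.

HB.instance Definition _ := Kernel_isProbability.Build _ _ _ _ _
  constant_kernel constant_kernel_prob.

Definition second_kernel (p : unit * Y) : {measure set Z -> \bar R} := k p.2.

Let measurable_second_kernel U : measurable U ->
  measurable_fun [set: unit * Y] (second_kernel ^~ U).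
Proof.
by move=> mU; apply: (measurableT_comp (mk mU)); exact: measurable_snd.
Qed.

HB.instance Definition _ := isKernel.Build _ _ _ _ _ second_kernel
  measurable_second_kernel.

Let second_kernel_prob x : second_kernel x [set: Z] = 1%E.
Proof. exact: k1. Qed.

HB.instance Definition _ := Kernel_isProbability.Build _ _ _ _ _
  second_kernel second_kernel_prob.

Definition mixture : {measure set Z -> \bar R} := mkcomp constant_kernel second_kernel tt.

Lemma mixtureE U : mixture U = (\int[m]_y k y U)%E.
Proof. by []. Qed.

Lemma mixture_setT : mixture [set: Z] = 1%E.
Proof.
rewrite mixtureE; under eq_integral do rewrite k1.
by rewrite integral_cst//= probability_setT mule1.
Qed.

Lemma integral_mixture (f : Z -> \bar R) : measurable_fun [set: Z] f ->
  (forall z, 0 <= f z)%E ->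
  (\int[mixture]_z f z = \int[m]_y \int[k y]_z f z)%E.
Proof. by move=> mf f0; rewrite /mixture /mkcomp /= integral_kcomp. Qed.

End mixture.

Section projections.
Context da db dc dd (A : measurableType da) (B : measurableType db)
  (C : measurableType dc) (D : measurableType dd).

Lemma measurable_fst_fst : measurable_fun setT (fun q : (A * B) * C => q.1.1).
Proof. exact: (measurableT_comp (@measurable_fst _ _ A B) (@measurable_fst _ _ _ C)). Qed.

Lemma measurable_fst_snd : measurable_fun setT (fun q : (A * B) * C => q.1.2).
Proof. exact: (measurableT_comp (@measurable_snd _ _ A B) (@measurable_fst _ _ _ C)). Qed.

Lemma measurable_comp_fst (f : A -> B) : measurable_fun setT f ->
  measurable_fun setT (fun q : A * C => f q.1).
Proof. by move=> mf; exact: (measurableT_comp mf (@measurable_fst _ _ A C)). Qed.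

End projections.

Section block_kernel.
Context {R : realType} {d : nat} (r lam : R) (lam_ge0 : 0 <= lam).
Local Notation row := 'rV[R]_d.
Local Notation config := (@config R d).
Implicit Types (X Y : {fset row}) (Z : config) (x v : row) (f : config -> R).
Variables (S : set row) (mS : measurable S) (S_fin : (volume S < +oo)%E) (L : R).

Let outside_pair (p : config * row) : config := outside p.2 L p.1.

Let measurable_outside_pair : measurable_fun setT outside_pair.
Proof.
pose D : set ((config * row) * row) := ~` [set q | euclidean_dist q.1.2 q.2 < L].
have mD : measurable D.
  apply: measurableC; apply: measurable_edist_lt; last exact: measurable_snd.
  exact: measurable_fst_snd.
have := measurable_moving_restriction (@measurable_fst _ _ config row) mD.
suff -> : outside_pair = (fun p => restriction (xsection D p) p.1) by [].
apply/funext => -[X x]; apply/fsetP => w.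
rewrite /outside_pair in_outside in_restriction; congr andb.
rewrite /xsection; apply/idP/idP; rewrite !inE/= inE/=.
  by move=> h; apply/negP; rewrite -leNgt.
by move/negP; rewrite -leNgt.
Qed.

Let free_set : set ((config * row) * row) :=
  [set q | free_region r S q.1.2 L q.1.1 q.2].

(** Being free is a vanishing count: no point of the configuration is both frozen and within [2 * r]
    of the candidate. The counting window moves with the update center and the candidate. *)
Let measurable_free_set : measurable free_set.
Proof.
pose D : set (((config * row) * row) * row) :=
  (~` [set q | euclidean_dist q.1.1.2 q.2 < L]) `&`
  [set q | euclidean_dist q.2 q.1.2 < 2 * r].
have m11 : measurable_fun setT (fun q : ((config * row) * row) * row => q.1.1.2).
  apply: (@measurable_comp_fst _ _ _ _ _ _ (fun q : config * row * row => q.1.2)).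
  exact: measurable_fst_snd.
have m12 : measurable_fun setT (fun q : ((config * row) * row) * row => q.1.2).
  exact: measurable_fst_snd.
have mD : measurable D.
  apply: measurableI; first by apply: measurableC; apply: measurable_edist_lt.
  exact: measurable_edist_lt.
have m1 : measurable_fun setT (fun q : (config * row) * row => q.1.1).
  exact: measurable_fst_fst.
have m2 : measurable_fun setT (fun q : (config * row) * row => q.1.2).
  exact: measurable_fst_snd.
rewrite (_ : free_set = (snd @^-1` S) `&`
  [set q | euclidean_dist q.1.2 q.2 < L] `&`
  [set q | count_in (xsection D q) (q.1.1) = 0%N]).
  apply: measurableI; last exact: measurable_moving_count.
  apply: measurableI; last by apply: measurable_edist_lt.
  by rewrite -[X in measurable X]setTI; exact: measurable_snd.
apply/seteqP; split => -[[X x] y] /=.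
  move=> [Sy xy h]; split => //; apply/eqP; rewrite /count_in cardfs_eq0.
  apply/eqP/fsetP => w; rewrite in_restriction in_fset0; apply/negbTE/negP.
  move=> /andP[wX]; rewrite /xsection !inE/= inE/= => -[/negP].
  rewrite -leNgt => Lw; apply/negP; rewrite -leNgt; apply: h.
  by rewrite in_outside wX.
move=> [[Sy xy] /eqP]; rewrite /count_in cardfs_eq0 => /eqP h; split => // w.
rewrite in_outside => /andP[wX Lw]; rewrite leNgt; apply/negP => wy.
have : w \in restriction (xsection D (X, x, y)) X.
  rewrite in_restriction wX /xsection !inE/= inE/=; split => //.
  by apply/negP; rewrite -leNgt.
by rewrite h in_fset0.
Qed.

Definition block_weight (p : config * row) : {measure set config -> \bar R} :=
  image_measure (gibbs r lam_ge0 (measurable_free_region r p.2 L p.1 mS))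
    (measurable_fsetUl (outside p.2 L p.1)).

(** Each term of the Gibbs series is the volume of a section of a jointly measurable set, hence
    measurable in the configuration and the update center. *)
Let measurable_block_weight U : measurable U ->
  measurable_fun [set: config * row] (block_weight ^~ U).
Proof.
move=> mU.
pose Q k : set ((config * row) * k.-tuple row) :=
  [set q | admissible r (free_region r S q.1.2 L q.1.1) q.2] `&`
  ((fun q => outside_pair q.1 `|` config_of_tuple q.2 : config)%fset @^-1` U).
have mQ k : measurable (Q k).
  apply: measurableI.
    have mD : measurable [set w : ((config * row) * k.-tuple row) * row | free_set (w.1.1, w.2)].
      rewrite -[X in measurable X]setTI.
      suff : measurable_fun setT
        (fun w : ((config * row) * k.-tuple row) * row => (w.1.1, w.2)) by exact.
      apply: measurable_fun_pair; last exact: measurable_snd.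
      exact: measurable_fst_fst.
    have := measurable_moving_admissible r mD (@measurable_snd _ _ (config * row)%type _).
    congr measurable; apply/funext => q /=; congr (admissible r _ q.2).
    by apply/seteqP; split => y; rewrite /xsection/= inE.
  rewrite -[X in measurable X]setTI.
  suff : measurable_fun setT (fun q : ((config * row) * k.-tuple row) =>
    outside_pair q.1 `|` config_of_tuple q.2 : config)%fset by exact.
  apply: measurable_add_tuple => //.
  exact: (measurable_comp_fst measurable_outside_pair).
rewrite [X in measurable_fun _ X](_ : _ = (fun p => \sum_(0 <= k <oo) ((lam ^+ k / k`!%:R)%:E *
    pow_measure volume k (xsection (Q k) p)))%E).
  apply: ge0_emeasurable_sum => [k p _ _|k _].
    by rewrite mule_ge0// lee_fin coef_ge0.
  apply: measurable_funeM; exact: (measurable_fun_xsection _ (mQ k)).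
apply/funext => p; rewrite /block_weight/= /pushforward -/(gibbs _ _ _) gibbsE.
apply: eq_eseriesr => k _; congr (_ * pow_measure _ _ _)%E.
by apply/seteqP; split => t; rewrite /xsection /Q/= inE.
Qed.

HB.instance Definition _ := isKernel.Build _ _ _ _ _ block_weight measurable_block_weight.

(** The kernel is taken jointly in configuration and update center, so that averaging over the
    center and iterating in time preserve measurability. *)
Definition block_kernel : R.-pker (config * row)%type ~> config :=
  knormalize block_weight (dirac (fset0 : config)).

End block_kernel.

Section uniform_law.
Context d (Y : measurableType d) (R : realType) (mu : {measure set Y -> \bar R}).
Variables (T : set Y) (mT : measurable T).
Hypotheses (T_gt0 : (0 < mu T)%E) (T_lty : (mu T < +oo)%E).

Definition uniform_law : probability Y R := mnormalize (mrestr mu mT) (dirac point).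

Lemma integral_uniform_law (f : Y -> \bar R) : measurable_fun [set: Y] f ->
  (forall x, 0 <= f x)%E ->
  (\int[uniform_law]_x f x = (\int[mu]_(x in T) f x) / mu T)%E.
Proof.
move=> mf f0.
have TE : mu T = (fine (mu T))%:E by rewrite fineK// ge0_fin_numE.
have t0 : 0 < fine (mu T) by rewrite -lte_fin -TE.
have c0 : 0 <= (fine (mu T))^-1 by rewrite invr_ge0 ltW.
transitivity (\int[mscale (NngNum c0) (mrestr mu mT)]_x f x)%E.
  apply: eq_measure_integral => A mA _.
  rewrite /uniform_law/= /mnormalize/= /mrestr/= setTI ifF; last first.
    by rewrite gt_eqF//= lt_eqF.
  by rewrite muleC.
rewrite ge0_integral_mscale// (ge0_integral_mrestr _ mT)//= muleC.
by rewrite [in RHS]TE inver gt_eqF.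
Qed.

End uniform_law.

Section heat_operator.
Context {R : realType} {d : nat} (r lam : R) (r_gt0 : 0 < r) (lam_ge0 : 0 <= lam).
Local Notation row := 'rV[R]_d.
Local Notation config := (@config R d).
Implicit Types (X Y : {fset row}) (Z : config) (x v : row) (f : config -> R).
Variables (S : set row) (mS : measurable S) (S_fin : (volume S < +oo)%E) (L : R).

Let kernel := block_kernel r lam_ge0 mS L.

Lemma block_kernelE (p : config * row) U : kernel p U =
  block_law r lam_ge0 mS p.2 L p.1
    ((fun Z => (outside p.2 L p.1 `|` Z)%fset : config) @^-1` U).
Proof.
have Ffin := free_region_lty r p.2 L p.1 mS S_fin.
rewrite /block_law gibbs_lawE//.
rewrite /kernel /block_kernel /= /knormalize /mnormalize ifF//.
apply/negbTE; rewrite negb_or; apply/andP; split.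
  by rewrite gt_eqF// (lt_le_trans _ (gibbs_ge1 r lam_ge0 (measurable_free_region r p.2 L p.1 mS))).
by rewrite lt_eqF//; exact: (gibbs_lty r lam_ge0 (measurable_free_region r p.2 L p.1 mS) Ffin).
Qed.

Lemma integral_block_kernel f (p : config * row) : unit_function f ->
  (\int[kernel p]_Z (f Z)%:E = (block_mean r lam_ge0 mS p.2 L f p.1)%:E)%E.
Proof.
move=> uf; have [mf f1] := uf.
have [mfu fu1] := unit_update (outside p.2 L p.1) uf.
rewrite /block_mean (meanE _ mfu fu1).
rewrite -(@ge0_integral_image _ _ _ _ _ (block_law r lam_ge0 mS p.2 L p.1) _
  (measurable_fsetUl (outside p.2 L p.1)) (fun Z => (f Z)%:E)).
- by apply: eq_measure_integral => A mA _; exact: block_kernelE.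
- exact/measurable_EFinP.
- by move=> Z; rewrite lee_fin; case/andP: (f1 Z).
Qed.

Lemma measurable_block_mean f : unit_function f ->
  measurable_fun setT (fun p : config * row => (block_mean r lam_ge0 mS p.2 L f p.1)%:E).
Proof.
move=> uf; have [mf f1] := uf.
rewrite [X in measurable_fun _ X](_ : _ = fun p => \int[kernel p]_Z (f Z)%:E)%E; last first.
  by apply/funext => p; rewrite integral_block_kernel.
apply: measurable_fun_integral_kernel.
- by move=> U mU; exact: measurable_kernel.
- by move=> Z; rewrite lee_fin; case/andP: (f1 Z).
- exact/measurable_EFinP.
Qed.

Lemma block_mean_unit f x X : unit_function f ->
  0 <= block_mean r lam_ge0 mS x L f X <= 1.
Proof. by move=> uf; apply: mean_unit; exact: unit_update. Qed.

Lemma unit_block_mean f X : unit_function f ->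
  unit_function (fun x => block_mean r lam_ge0 mS x L f X).
Proof.
move=> uf; split; last by move=> x; exact: block_mean_unit.
have := measurableT_comp (measurable_block_mean uf) (pair1_measurable (X : config)).
by move/measurable_EFinP.
Qed.

Variable nu : probability row R.

Let measurable_kernel_at X U : measurable U ->
  measurable_fun [set: row] (fun x => kernel (X, x) U).
Proof.
move=> mU.
exact: (measurableT_comp (measurable_kernel kernel U mU) (pair1_measurable (X : config))).
Qed.

Let kernel_at_setT X x : kernel (X, x) [set: config] = 1%E.
Proof. exact: prob_kernel. Qed.

Definition heat_law (X : config) : {measure set config -> \bar R} :=
  mixture nu (measurable_kernel_at X).

Lemma heat_lawE X U : heat_law X U =
  (\int[nu]_x block_law r lam_ge0 mS x L X
    ((fun Z => (outside x L X `|` Z)%fset : config) @^-1` U))%E.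
Proof. by rewrite /heat_law mixtureE; apply: eq_integral => x _; rewrite block_kernelE. Qed.

Definition heat_operator f (X : config) : R := mean nu (fun x => block_mean r lam_ge0 mS x L f X).

Lemma measurable_heat_law U : measurable U ->
  measurable_fun setT (fun X : config => heat_law X U).
Proof.
move=> mU.
exact: (measurable_fun_fubini_tonelli_F (m2 := nu) (fun p => kernel p U)
  (measurable_kernel kernel U mU)).
Qed.

Lemma integral_heat_law f X : unit_function f ->
  (\int[heat_law X]_Z (f Z)%:E = (heat_operator f X)%:E)%E.
Proof.
move=> uf; have [mf f1] := uf; have [mb b1] := unit_block_mean X uf.
rewrite /heat_operator (meanE _ mb b1) (integral_mixture _ _ (kernel_at_setT X)).
- by apply: eq_integral => x _; rewrite integral_block_kernel.
- exact/measurable_EFinP.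
- by move=> Z; rewrite lee_fin; case/andP: (f1 Z).
Qed.

Lemma unit_heat_operator f : unit_function f -> unit_function (heat_operator f).
Proof.
move=> uf; split; last by move=> X; apply: mean_unit; exact: unit_block_mean.
apply/measurable_EFinP.
rewrite (_ : _ \o _ = (fun X : config => \int[nu]_x (block_mean r lam_ge0 mS x L f X)%:E)%E).
  apply: (measurable_fun_fubini_tonelli_F (m2 := nu) _ (measurable_block_mean uf)).
  by move=> p; rewrite lee_fin; case/andP: (block_mean_unit p.2 p.1 uf).
apply/funext => X /=; have [mb b1] := unit_block_mean X uf.
by rewrite /heat_operator (meanE _ mb b1).
Qed.

(** The identity for events says that the law of [X1] is the mixture of the kernel along [X0];
    integrating [f] against both measures extends it to functions. *)
Lemma mean_heat_step dT (T : measurableType dT) (P : probability T R)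
    (X0 X1 : T -> config) f :
  measurable_fun setT X0 -> measurable_fun setT X1 ->
  (forall E, measurable E -> P (X1 @^-1` E) = (\int[P]_w heat_law (X0 w) E)%E) ->
  unit_function f ->
  mean P (f \o X1) = mean P (heat_operator f \o X0).
Proof.
move=> mX0 mX1 step uf; have [mf f1] := uf.
have mk U : measurable U -> measurable_fun setT (fun w => heat_law (X0 w) U).
  by move=> mU; exact: (measurableT_comp (measurable_heat_law mU) mX0).
have k1 w : heat_law (X0 w) [set: config] = 1%E by apply: mixture_setT; exact: kernel_at_setT.
congr fine; rewrite -(@ge0_integral_image _ _ _ _ _ P _ mX1 (fun Z => (f Z)%:E)).
- transitivity (\int[mixture P mk]_Z (f Z)%:E)%E.
    by apply: eq_measure_integral => A mA _; exact: step.
  rewrite (integral_mixture _ _ k1).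
  + by apply: eq_integral => w _; rewrite integral_heat_law.
  + exact/measurable_EFinP.
  + by move=> Z; rewrite lee_fin; case/andP: (f1 Z).
- exact/measurable_EFinP.
- by move=> Z; rewrite lee_fin; case/andP: (f1 Z).
Qed.

End heat_operator.

(** * Contraction *)

Lemma uniform_lawE d (Y : measurableType d) (R : realType)
    (mu : {measure set Y -> \bar R}) (T : set Y) (mT : measurable T) (D : set Y) :
  (0 < mu T)%E -> (mu T < +oo)%E ->
  (uniform_law mu mT D = mu (D `&` T) * (fine (mu T))^-1%:E)%E.
Proof.
move=> T0 Ty.
by rewrite /uniform_law/= /mnormalize/= /mrestr/= setTI ifF// gt_eqF//= lt_eqF.
Qed.

Lemma ler_dist_two (R : realDomainType) (a b e : R) :
  a <= b + e -> b <= a + e -> `|a - b| <= e.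
Proof. by move=> ab ba; rewrite ler_distl lerBlDr ab ba. Qed.

Section mean_comparison.
Context d (T : measurableType d) (R : realType) (P : probability T R).
Implicit Types f g h : T -> R.

Lemma mean_leD f g h M N H : measurable_fun [set: T] f -> measurable_fun [set: T] g ->
  measurable_fun [set: T] h -> (forall x, 0 <= f x <= M) ->
  (forall x, 0 <= g x <= N) -> (forall x, 0 <= h x <= H) ->
  (forall x, f x <= g x + h x) -> mean P f <= mean P g + mean P h.
Proof.
move=> mf mg mh fM gN hH fgh.
rewrite -lee_fin EFinD (meanE P mf fM) (meanE P mg gN) (meanE P mh hH).
rewrite -ge0_integralD//=; first last.
  - exact/measurable_EFinP.
  - by move=> x _; rewrite lee_fin; case/andP: (hH x).
  - exact/measurable_EFinP.
  - by move=> x _; rewrite lee_fin; case/andP: (gN x).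
apply: ge0_le_integral => //.
- by move=> x _; rewrite lee_fin; case/andP: (fM x).
- exact/measurable_EFinP.
- by apply: emeasurable_funD => //; exact/measurable_EFinP.
- by move=> x _; rewrite -EFinD lee_fin.
Qed.

Lemma mean_cst a : 0 <= a -> mean P (fun=> a) = a.
Proof. by move=> a0; rewrite /mean integral_cst//= probability_setT mule1. Qed.

Lemma mean_indic (D : set T) : measurable D -> mean P \1_D = fine (P D).
Proof. by move=> mD; rewrite /mean integral_indic// setIT. Qed.

Lemma mean_weighted_indic (D1 D2 : set T) (a b : R) : measurable D1 -> measurable D2 ->
  0 <= a -> 0 <= b ->
  mean P (fun x => a * \1_D1 x + b * \1_D2 x) = a * fine (P D1) + b * fine (P D2).
Proof.
move=> mD1 mD2 a0 b0; rewrite /mean.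
have ge0 (D : set T) e : 0 <= e -> forall x, setT x -> (0 <= (e * \1_D x)%:E)%E.
  by move=> e0 x _; rewrite lee_fin mulr_ge0.
have md (D : set T) e : measurable D -> measurable_fun [set: T] (fun x => (e * \1_D x)%:E).
  by move=> mD; apply/measurable_EFinP; exact: measurable_funM.
under eq_integral do rewrite EFinD.
rewrite ge0_integralD//; [|exact: ge0|exact: md|exact: ge0|exact: md].
have int (D : set T) e : measurable D -> 0 <= e ->
    (\int[P]_x (e * \1_D x)%:E = (e * fine (P D))%:E)%E.
  move=> mD e0; under eq_integral do rewrite EFinM.
  rewrite ge0_integralZl//; last exact/measurable_EFinP.
  by rewrite integral_indic// setIT EFinM fineK// fin_num_measure.
by rewrite !int.
Qed.

Lemma mean_near f (a dl : R) M : measurable_fun [set: T] f -> (forall x, 0 <= f x <= M) ->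
  0 <= a -> 0 <= dl -> (forall x, `|f x - a| <= dl) -> `|mean P f - a| <= dl.
Proof.
move=> mf fM a0 dl0 fa.
have ma e : measurable_fun [set: T] (fun=> e : R) by exact: measurable_cst.
have ra (e : R) : 0 <= e -> forall x : T, 0 <= e <= e by move=> ->; rewrite lexx.
have := mean_leD mf (ma a) (ma dl) fM (ra _ a0) (ra _ dl0).
have := mean_leD (ma a) mf (ma dl) (ra _ a0) fM (ra _ dl0).
rewrite !mean_cst// => h1 h2; rewrite ler_distl lerBlDr; apply/andP; split.
  by apply: h1 => x; have := fa x; rewrite ler_distl lerBlDr => /andP[].
by apply: h2 => x; have := fa x; rewrite ler_distl => /andP[].
Qed.

End mean_comparison.

Section contraction.
Context {R : realType} {d : nat} (r lam : R) (r_gt0 : 0 < r) (lam_ge0 : 0 <= lam)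
  (ball_volume : volume (euclidean_ball (0 : 'rV[R]_d) r) = 1%E).
Local Notation row := 'rV[R]_d.
Local Notation config := (@config R d).
Implicit Types (X Y : {fset row}) (Z : config) (x v : row) (f : config -> R).
Variables (alpha beta : R).
Hypotheses (alpha_gt0 : 0 < alpha) (beta_gt0 : 0 < beta).
Hypothesis ssm : forall A' A, region A' -> region A -> A' `<=` A ->
  forall tau tau', boundary_condition r A tau -> boundary_condition r A tau' ->
  (local_total_variation r A' (hard_sphere_model r lam A tau) (hard_sphere_model r lam A tau') <=
   beta%:E * @volume R d A' * expeR (- (alpha%:E * set_dist (tau `+` tau') A')))%E.
Variables (A S : set row) (mS : measurable S).
Hypotheses (rA : region A) (SA : S `<=` centers r A) (S_fin : (volume S < +oo)%E).
Variables (L K : R).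
Hypotheses (L_gt0 : 0 < L) (K_gt0 : 0 < K).
Let T := thickening (centers r A) L.
Let mT : measurable T := measurable_thickening (centers r A) L.
Hypotheses (T_gt0 : (0 < volume T)%E) (T_lty : (volume T < +oo)%E).

Let W : R := @influence_bound R d r alpha beta L K.
Hypothesis annulus_small :
  W * (((L + 2 * r) / r) ^+ d - (L / r) ^+ d) <= (L / r) ^+ d / 2.

(** The gain from the ball around the disagreement, halved to pay for the annulus, relative to the
    volume of all update centers. *)
Definition contraction_rate : R := 1 - (L / r) ^+ d / 2 / fine (volume T).

Let nu := uniform_law volume mT.

Lemma influence_bound_ge0 : 0 <= @influence_bound R d r alpha beta L K.
Proof.
have r0 := ltW r_gt0; have L0 := ltW L_gt0; have K0 := ltW K_gt0.
rewrite /influence_bound /mixing_error; have e0 := expR_ge0 (- (alpha * K)).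
by rewrite addr_ge0 ?mulr_ge0 ?exprn_ge0 ?divr_ge0 ?addr_ge0 ?mulr_ge0// ltW.
Qed.

Lemma eball_sub_thickening v : centers r A v -> euclidean_ball v L `<=` T.
Proof.
move=> Av x vx; rewrite /T /thickening/=.
by rewrite (le_trans (@set_dist_le _ _ _ _ x v _ _))// lee_fin edistC ltW.
Qed.

Lemma heat_operator_contracts f c : unit_function f -> 0 <= c ->
  point_lipschitz r S c f ->
  point_lipschitz r S (contraction_rate * c) (heat_operator r lam_ge0 mS L nu f).
Proof.
move=> uf c0 lf X v vX pX; pose X1 := (v |` X)%fset.
have Av : centers r A v by apply: SA; case: pX => _; apply; rewrite in_fset1U eqxx.
have W0 := influence_bound_ge0.
pose D1 : set row := ~` euclidean_ball v L.
pose D2 : set row := euclidean_ball v (L + 2 * r) `\` euclidean_ball v L.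
have mD1 : measurable D1 by apply: measurableC; exact: measurable_eball.
have mD2 : measurable D2 by apply: measurableD; exact: measurable_eball.
(* A surviving [v] costs [c] on all of [D1]; on the annulus [D2], which is part of [D1], the changed
   law adds [c * W]. *)
pose g x := c * \1_D1 x + c * W * \1_D2 x.
have cW : 0 <= c * W by rewrite mulr_ge0.
have mg : measurable_fun setT g.
  by apply: measurable_funD; apply: measurable_funM => //; exact: measurable_indic.
have g_range x : 0 <= g x <= c + c * W.
  have i0 (D : set row) : 0 <= (\1_D x : R) by rewrite indicE; case: (x \in D).
  have i1 (D : set row) : (\1_D x : R) <= 1.
    by rewrite indicE; case: (x \in D); rewrite ?lexx ?ler01.
  apply/andP; split; first by apply: addr_ge0; apply: mulr_ge0.
  by apply: lerD; apply: ler_piMr.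
have close x : `|block_mean r lam_ge0 mS x L f X1 - block_mean r lam_ge0 mS x L f X| <= g x.
  rewrite /g; have [xv|Lxv] := ltP (euclidean_dist x v) L.
    have vx : euclidean_ball v L x by rewrite /euclidean_ball/= edistC.
    have n1 : ~ D1 x by apply.
    have n2 : ~ D2 x by case.
    by rewrite block_mean_inner// subrr normr0 !indicE (memNset n1) (memNset n2) !mulr0 addr0.
  have xD1 : D1 x by rewrite /D1 /euclidean_ball/= edistC; apply/negP; rewrite -leNgt.
  have [far|near] := leP (L + 2 * r) (euclidean_dist x v).
    apply: (@le_trans _ _ c); first exact: block_mean_outer.
    by rewrite indicE mem_set// mulr1 lerDl mulr_ge0.
  rewrite !indicE !mem_set//; last by split => //; rewrite /euclidean_ball/= edistC.
  rewrite !mulr1 -[in leRHS](mulr1 c) -mulrA mul1r -mulrDr.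
  exact: (@block_mean_annulus R d r lam r_gt0 lam_ge0 ball_volume alpha beta
    alpha_gt0 beta_gt0 ssm A).
have [mb1 b1] := unit_block_mean r lam_ge0 mS S_fin L X1 uf.
have [mb0 b0] := unit_block_mean r lam_ge0 mS S_fin L X uf.
have up : heat_operator r lam_ge0 mS L nu f X1 <=
    heat_operator r lam_ge0 mS L nu f X + mean nu g.
  exact: (mean_leD nu mb1 mb0 mg b1 b0 g_range (fun x => ler_distlDr (close x))).
have dn : heat_operator r lam_ge0 mS L nu f X <=
    heat_operator r lam_ge0 mS L nu f X1 + mean nu g.
  exact: (mean_leD nu mb0 mb1 mg b0 b1 g_range (fun x => ler_distlCDr (close x))).
apply: (@le_trans _ _ (mean nu g)).
  exact: (ler_dist_two up dn).
pose V := fine (volume T); pose b := (L / r) ^+ d; pose b2 := ((L + 2 * r) / r) ^+ d.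
have VE : volume T = V%:E by rewrite fineK// ge0_fin_numE.
have V0 : 0 < V by rewrite -lte_fin -VE.
have L20 : 0 < L + 2 * r by rewrite addr_gt0// mulr_gt0.
have bE : volume (euclidean_ball v L) = b%:E by exact: volume_eball.
have b2E : volume (euclidean_ball v (L + 2 * r)) = b2%:E by exact: volume_eball.
(* This is an equality because the whole ball about [v] consists of possible update centers. *)
have nu1 : fine (nu D1) = 1 - b / V.
  rewrite uniform_lawE// (_ : D1 `&` T = T `\` euclidean_ball v L); last by rewrite setIC.
  rewrite measureD//; last exact: measurable_eball.
  rewrite setIidr; last exact: eball_sub_thickening.
  rewrite -/V; have -> : (volume T - volume (euclidean_ball v L) = (V - b)%:E)%E by rewrite VE bE.
  by rewrite -EFinM/= mulrBl divff// gt_eqF.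
(* The annulus may stick out of [T], so its probability is only bounded from above. *)
have nu2 : fine (nu D2) <= (b2 - b) / V.
  have D2E : volume D2 = (b2 - b)%:E.
    rewrite /D2 measureD//; [|exact: measurable_eball|exact: measurable_eball|].
      rewrite setIidr; last first.
        move=> x; rewrite /euclidean_ball/= => /lt_le_trans; apply.
        by rewrite lerDl mulr_ge0// ltW.
      by rewrite EFinB; congr (_ - _)%E.
    by move: b2E => /= ->; exact: ltry.
  have D2T : (volume (D2 `&` T) <= (b2 - b)%:E)%E.
    by rewrite -D2E; apply: le_measure; rewrite ?inE//; exact: measurableI.
  have D2n : volume (D2 `&` T) = (fine (volume (D2 `&` T)))%:E.
    by rewrite fineK// ge0_fin_numE// (le_lt_trans D2T)// ltry.
  have -> : nu D2 = (fine (volume (D2 `&` T)) / V)%:E.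
    by rewrite uniform_lawE// EFinM -D2n.
  rewrite /= ler_wpM2r ?invr_ge0 ?(ltW V0)//.
  by rewrite -lee_fin -D2n.
rewrite /g mean_weighted_indic// nu1.
apply: (@le_trans _ _ (c * (1 - b / V) + c * W * ((b2 - b) / V))).
  by rewrite lerD2l ler_wpM2l.
rewrite /contraction_rate -/V -/b [leRHS]mulrC.
have -> : c * (1 - b / V) + c * W * ((b2 - b) / V) =
  c * (1 - b / V + W * (b2 - b) / V) by ring.
apply: ler_wpM2l => //.
have -> : 1 - b / 2 / V = 1 - b / V + b / 2 / V by field; rewrite gt_eqF.
by rewrite lerD2l ler_wpM2r// invr_ge0 ltW.
Qed.

End contraction.

(** * Choice of the constants *)

Section constants.
Context {R : realType}.
Implicit Types (x y u a C : R).

(** Factoring the difference of powers leaves [n.+1] terms, each at most [x ^+ n]. *)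
Lemma subX_le (n : nat) x y : 0 <= y -> y <= x ->
  x ^+ n.+1 - y ^+ n.+1 <= (x - y) * (n.+1%:R * x ^+ n).
Proof.
move=> y0 yx; have x0 := le_trans y0 yx.
rewrite subrXX ler_wpM2l ?subr_ge0//.
rewrite mulr_natl -[X in _ *+ X](card_ord n.+1) -sumr_const; apply: ler_sum => i _.
have -> : x ^+ n = x ^+ (n - i) * x ^+ i by rewrite -exprD subnK// -ltnS ltn_ord.
by rewrite ler_wpM2l ?exprn_ge0// lerXn2r.
Qed.

Lemma annulus_volume_le (d : nat) x : (0 < d)%N -> 1 <= x ->
  (x + 2) ^+ d - x ^+ d <= 2 * d%:R * 3 ^+ d * x ^+ d.-1.
Proof.
case: d => // n _ x1; have x0 : 0 <= x by rewrite (le_trans _ x1).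
apply: le_trans (subX_le n x0 _) _; first by rewrite lerDl.
rewrite [x + 2]addrC addrK /= -!mulrA ler_wpM2l// ler_wpM2l//.
have h : 2 + x <= 3 * x by rewrite -subr_ge0 (_ : _ - _ = 2 * (x - 1)) ?mulr_ge0 ?subr_ge0//; ring.
apply: (@le_trans _ _ ((3 * x) ^+ n)).
  by rewrite lerXn2r ?nnegrE// ?addr_ge0 ?mulr_ge0.
rewrite exprMn ler_wpM2r ?exprn_ge0// exprS ler_peMl ?exprn_ge0//.
by rewrite ler1n.
Qed.

Lemma root_exists (d : nat) x : (0 < d)%N -> 0 <= x -> exists2 u, 0 <= u & u ^+ d = x.
Proof.
move=> d0 x0; exists (x `^ (d%:R^-1)); first exact: powR_ge0.
rewrite -powR_mulrn ?powR_ge0// -powRrM mulVf ?powRr1// pnatr_eq0.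
by rewrite -lt0n.
Qed.

Lemma expRN_le (n : nat) x : 0 < x -> expR (- x) <= n.+1`!%:R / x ^+ n.+1.
Proof.
move=> x0; rewrite expRN -[leRHS]invrK invf_div lef_pV2 ?posrE ?expR_gt0//.
  apply: le_trans (expR_ge1Dxn n (ltW x0)).
  by rewrite lerDr.
by rewrite divr_gt0// ?exprn_gt0// ltr0n fact_gt0.
Qed.

Lemma quadratic_le x : 1 <= x -> (x + 1) * (x + 2) <= 9 * x ^+ 2.
Proof. by move=> x1; nra. Qed.

(* K is taken of order L^(1/d): then K^d is a small multiple of L, while
   exp(-alpha K) beats every power of L. *)
Lemma block_size_choice (d : nat) (r alpha beta : R) : (0 < d)%N -> 0 < r ->
  0 < alpha -> 0 < beta ->
  exists2 L0, 0 < L0 & forall L, L0 <= L -> exists2 K, 0 < K &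
  @influence_bound R d r alpha beta L K *
    (((L + 2 * r) / r) ^+ d - (L / r) ^+ d) <= (L / r) ^+ d / 2.
Proof.
move=> d0 r0 al0 be0.
(* The constant of [annulus_volume_le], applied to the ratio [p] of [L] and [r]. *)
pose C : R := 2 * d%:R * 3 ^+ d.
have C0 : 0 < C by rewrite !mulr_gt0 ?exprn_gt0// ltr0n.
(* With exponent [d * (2 * d)], the polynomial bound on the exponential cancels [p ^+ (2 * d)], as
   [p] will be a multiple of [u ^+ d]. *)
pose N := (d * (2 * d)).-1.
have NE : N.+1 = (d * (2 * d))%N by rewrite prednK// !muln_gt0 d0.
(* For [8 <= u] one has [u / 2 <= u - 4], so the decay at distance [(u - 4) * r] is at least that of
   [expR (- (a * u))]. *)
pose a : R := alpha * r / 2.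
have a0 : 0 < a by rewrite divr_gt0// mulr_gt0.
(* The constant left of the exponential term once all powers of [u] have cancelled. *)
pose Q : R := 8 * C * beta * 9 ^+ d * (8 * C) ^+ (2 * d) * (N.+1`!%:R / a ^+ N.+1).
have Q0 : 0 <= Q.
  by rewrite /Q; do ![apply: mulr_ge0 | apply: exprn_ge0 | rewrite invr_ge0 | exact: ltW | done].
have c8 : 0 <= 8 * C * 8 ^+ d by rewrite !mulr_ge0 ?exprn_ge0 ?(ltW C0).
(* The three summands give [1 <= p], absorb the exponential term, and force [8 <= u]. *)
exists (r * (1 + Q + 8 * C * 8 ^+ d)).
  by rewrite mulr_gt0// -addrA ltr_pwDl// addr_ge0.
move=> L hL; pose p := L / r.
have hp : 1 + Q + 8 * C * 8 ^+ d <= p by rewrite ler_pdivlMr// mulrC.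
have p1 : 1 <= p by rewrite (le_trans _ hp)// -addrA lerDl addr_ge0.
have pQ : Q <= p by rewrite (le_trans _ hp)// addrAC lerDr addr_ge0.
have p8 : 8 * C * 8 ^+ d <= p by rewrite (le_trans _ hp)// lerDr addr_ge0.
have p0 : 0 < p by rewrite (lt_le_trans _ p1).
(* With this [u] the packing term uses up exactly half of the allowed loss; the mixing term gets the
   other half. *)
have [u u0 uE] : exists2 u, 0 <= u & u ^+ d = p / (8 * C).
  by apply: root_exists => //; apply: divr_ge0; [exact: ltW|apply: mulr_ge0 => //; exact: ltW].
have C8 : 0 < 8 * C by rewrite mulr_gt0.
have pE : p = 8 * C * u ^+ d by rewrite uE mulrC divfK// gt_eqF.
have u8 : 8 <= u.
  rewrite -(@ler_pXn2r _ d)// ?nnegrE// uE ler_pdivlMr//.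
  by rewrite mulrC.
have up : 0 < u by rewrite (lt_le_trans _ u8).
(* The shift by 4 turns the packing bound at radius [K + 3 * r] into [u ^+ d]. *)
exists ((u - 4) * r).
  by rewrite mulr_gt0// subr_gt0 (lt_le_trans _ u8)// ltr_nat.
have E1 : ((u - 4) * r + 3 * r + r) / r = u by field; rewrite gt_eqF.
have E2 : (L + r) / r = p + 1 by rewrite mulrDl divff ?gt_eqF.
have E3 : (L + 2 * r) / r = p + 2 by rewrite mulrDl mulfK ?gt_eqF.
rewrite /influence_bound /mixing_error E1 E2 E3 -/p.
set e := expR _.
have e0 : 0 <= e by exact: expR_ge0.
have e_le : e <= N.+1`!%:R / (a * u) ^+ N.+1.
  apply: le_trans (expRN_le N _); last by rewrite mulr_gt0.
  rewrite ler_expR lerN2 /a (_ : alpha * ((u - 4) * r) = alpha * r * (u - 4)); last by ring.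
  rewrite -mulrA ler_wpM2l ?mulr_ge0 ?(ltW al0) ?(ltW r0)//.
  by rewrite mulrC lerBrDl -lerBrDr (_ : u - u / 2 = u / 2) ?ler_pdivlMr//; [rewrite -natrM|field].
have ann := annulus_volume_le d0 p1; rewrite -/C in ann.
have pd1 : 0 <= p ^+ d.-1 by rewrite exprn_ge0// ltW.
set bnd := (X in X * _ <= _).
have t2 : 2 * (p + 1) ^+ d * (beta * (p + 2) ^+ d * e) * (4 * C) <= p.
  apply: le_trans pQ.
  have m9 : (p + 1) ^+ d * (p + 2) ^+ d <= 9 ^+ d * p ^+ (2 * d).
    rewrite -exprMn exprM -exprMn; apply: lerXn2r; rewrite ?nnegrE.
    - by apply: mulr_ge0; apply: addr_ge0 => //; exact: ltW.
    - by apply: mulr_ge0 => //; exact: sqr_ge0.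
    - exact: quadratic_le.
  have -> : 2 * (p + 1) ^+ d * (beta * (p + 2) ^+ d * e) * (4 * C) =
    8 * C * beta * (((p + 1) ^+ d * (p + 2) ^+ d) * e) by ring.
  have -> : Q = 8 * C * beta * (9 ^+ d * p ^+ (2 * d) * (N.+1`!%:R / (a * u) ^+ N.+1)).
    rewrite /Q pE [(8 * C * u ^+ d) ^+ _]exprMn -exprM -NE [(a * u) ^+ _]exprMn.
    have un0 : u ^+ N.+1 != 0 by rewrite expf_neq0 ?gt_eqF.
    have an0 : a ^+ N.+1 != 0 by rewrite expf_neq0 ?gt_eqF.
    by field; rewrite un0 an0.
  apply: ler_wpM2l; first by rewrite !mulr_ge0 ?(ltW be0) ?(ltW C0).
  by apply: ler_pM; rewrite ?mulr_ge0 ?exprn_ge0 ?addr_ge0 ?(ltW p0).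
have t1 : 2 * u ^+ d * (4 * C) = p by rewrite pE; ring.
have bnd0 : 0 <= bnd.
  by rewrite /bnd !(addr_ge0, mulr_ge0) ?exprn_ge0 ?addr_ge0 ?(ltW be0) ?(ltW p0).
have bC : bnd * C <= p / 2.
  have -> : bnd * C = (2 * u ^+ d * (4 * C) +
      2 * (p + 1) ^+ d * (beta * (p + 2) ^+ d * e) * (4 * C)) / 4.
    by rewrite /bnd; field.
  by rewrite t1 ler_pdivrMr// (_ : p / 2 * 4 = p + p) ?lerD2l//; field.
apply: (@le_trans _ _ (bnd * (C * p ^+ d.-1))); first by rewrite ler_wpM2l.
rewrite mulrA; apply: (@le_trans _ _ (p / 2 * p ^+ d.-1)); first by rewrite ler_wpM2r.
by rewrite mulrAC -exprS prednK.
Qed.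

End constants.

(** * Volume of the set of update centers *)

Section thickened_volume.
Context {R : realType} {d : nat} (r : R) (r_gt0 : 0 < r)
  (ball_volume : volume (euclidean_ball (0 : 'rV[R]_d) r) = 1%E).
Implicit Types (x y v : 'rV[R]_d) (A B C : set 'rV[R]_d) (X : {fset 'rV[R]_d}).

Lemma compact_volume_lty A : measurable A -> compact A -> (volume A < +oo)%E.
Proof.
move=> mA cA.
have cB : compact ((fun y => euclidean_dist 0 y : R^o) @` A).
  apply: continuous_compact => //; apply: continuous_subspaceT.
  exact: continuous_edist.
have [M [_ hM]] := compact_bounded cB.
pose l := `|M| + 2.
have l0 : 0 < l by rewrite ltr_wpDl.
apply: (@le_lt_trans _ _ ((l / r) ^+ d)%:E); last exact: ltry.
rewrite -(volume_eball r_gt0 ball_volume 0 l0).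
apply: le_measure; rewrite ?inE//; first exact: measurable_eball.
move=> y Ay; rewrite /euclidean_ball/=.
have Ml : M < `|M| + 1 by rewrite (le_lt_trans (ler_norm M))// ltrDl.
have := hM _ Ml _ (ex_intro2 _ _ y Ay erefl).
rewrite /= ger0_norm ?edist_ge0// => /le_lt_trans; apply.
by rewrite /l ltrD2l ltr1n.
Qed.

Lemma packed_card A X : measurable A -> (volume A < +oo)%E ->
  packed r (centers r A) X -> (#|` X|)%:R <= fine (volume A).
Proof.
move=> mA Afin [hX XA]; rewrite -lee_fin fineK ?ge0_fin_numE//.
by apply: (packing_bound r_gt0 ball_volume) => // x /XA; exact: centers_ball.
Qed.

(** Cardinalities are bounded by the volume of [A], so a packing of greatest cardinality exists; a
    center far from all its points could be added to it. *)
Lemma maximal_packing A : measurable A -> (volume A < +oo)%E ->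
  exists2 X, packed r (centers r A) X &
    forall y, centers r A y -> exists2 x, x \in X & euclidean_dist x y < 2 * r.
Proof.
move=> mA Afin.
pose P n := `[< exists2 X, packed r (centers r A) X & #|` X| = n >].
have exP : exists n, P n.
  exists 0%N; apply/asboolP; exists fset0; last by rewrite cardfs0.
  by split => [x y|x]; rewrite (in_fset0 x).
have ubP n : P n -> (n <= Num.truncn (fine (volume A)))%N.
  move=> /asboolP[X pX <-]; have := packed_card mA Afin pX.
  by rewrite truncn_ge_nat ?fine_ge0.
case: (ex_maxnP exP ubP) => n /asboolP[X pX Xn] maxn.
exists X => // y Ay; apply: contrapT => far.
have farX x : x \in X -> 2 * r <= euclidean_dist x y.
  by move=> xX; rewrite leNgt; apply/negP => xy; apply: far; exists x.
have yX : y \notin X.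
  by apply/negP => /farX; rewrite edistxx leNgt mulr_gt0.
have pyX : packed r (centers r A) (y |` X)%fset.
  have [hX XA] := pX; split => [u w|u]; last by rewrite in_fset1U => /orP[/eqP ->|/XA].
  rewrite !in_fset1U => /orP[/eqP ->|uX] /orP[/eqP ->|wX] uw.
  - by rewrite eqxx in uw.
  - by rewrite edistC; exact: farX.
  - exact: farX.
  - exact: hX.
have : P n.+1 by apply/asboolP; exists (y |` X)%fset => //; rewrite cardfsU1 yX Xn.
by move/maxn; rewrite ltnn.
Qed.

(** Enlarged balls about a maximal packing cover the thickening, and the packing has at most
    [fine (volume A)] points. The covering needs [2 * r]; the third [r] is slack for an infimum that
    need not be attained. *)
Lemma thickening_volume_le A L : measurable A -> (volume A < +oo)%E -> 0 < L ->
  (volume (thickening (centers r A) L) <=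
   (fine (volume A) * ((L + 3 * r) / r) ^+ d)%:E)%E.
Proof.
move=> mA Afin L0; have [X pX cover] := maximal_packing mA Afin.
have l0 : 0 < L + 3 * r by rewrite addr_gt0// mulr_gt0.
have mb x : measurable (euclidean_ball x (L + 3 * r)) by exact: measurable_eball.
apply: (@le_trans _ _ (\sum_(x \in [set` X]) volume (euclidean_ball x (L + 3 * r)))%E).
  apply: content_sub_fsum => //; first exact: measurable_thickening.
  move=> y yT.
  have /set_dist_lt[_ [c [-> Ac yc]]] : (set_dist [set y] (centers r A) < (L + r)%:E)%E.
    by rewrite (le_lt_trans yT)// lte_fin ltrDl.
  have [x xX xc] := cover _ Ac; exists x => //.
  rewrite /euclidean_ball/= (le_lt_trans (edist_triangle c _ _))//.
  by rewrite (_ : L + 3 * r = 2 * r + (L + r)); [rewrite ltrD// edistC|ring].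
rewrite (eq_fsbigr (fun=> (((L + 3 * r) / r) ^+ d)%:E)); last first.
  by move=> x _; rewrite (volume_eball r_gt0 ball_volume).
rewrite fsbig_finite//= set_fsetK sumEFin lee_fin big_const_seq count_predT iter_addr_0.
rewrite -[leLHS]mulr_natl ler_wpM2r//.
  by rewrite exprn_ge0// divr_ge0// ltW.
exact: packed_card.
Qed.

End thickened_volume.

(** * The heat-bath kernel as a mixture of block laws *)

Section heat_bath_identification.
Context {R : realType} {d : nat} (r lam : R) (lam_ge0 : 0 <= lam).
Local Notation row := 'rV[R]_d.
Local Notation config := (@config R d).
Implicit Types (X : config) (A tau : set row) (L : R).

Lemma resampleE A tau (mS : measurable (centers r A `\` tau)) x L X E :
  (volume (centers r A `\` tau) < +oo)%E -> configurations r A tau X ->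
  resample r lam A tau (euclidean_ball x L) X E =
  block_law r lam_ge0 mS x L X ((fun Z => (outside x L X `|` Z)%fset : config) @^-1` E).
Proof.
move=> Sfin [hX XS]; apply: conditional_poissonE; first exact: free_region_lty.
move=> k t; split => [[tS ht]|[tS ht]].
  split => [i|].
    have [Si xi] := tS i; split => // w wX; apply: ht.
    - by rewrite in_fsetU wX.
    - by rewrite in_fsetU in_config_of_tuple mem_tnth orbT.
    (* A new point differs from every frozen one, as only the new point lies in the update ball. *)
    - apply/eqP => wi; move: wX; rewrite in_outside wi => /andP[_].
      by rewrite leNgt => /negP; apply.
  move=> y z yt zt; apply: ht; rewrite in_fsetU; apply/orP; right; [exact: yt|exact: zt].
split => [i|]; first by have [Si xi _] := tS i.
have pZ : packed r (free_region r (centers r A `\` tau) x L X) (config_of_tuple t).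
  by split => // y; rewrite in_config_of_tuple => /tnthP[i ->].
by have [] := packed_update (conj hX XS) pZ.
Qed.

Lemma heat_bathE A tau (mS : measurable (centers r A `\` tau)) L X E :
  (volume (centers r A `\` tau) < +oo)%E -> configurations r A tau X ->
  (0 < volume (thickening (centers r A) L))%E ->
  (volume (thickening (centers r A) L) < +oo)%E -> measurable E ->
  heat_bath r lam L A tau X E =
  heat_law r lam_ge0 mS L (uniform_law volume (measurable_thickening (centers r A) L)) X E.
Proof.
move=> Sfin XA T0 Ty mE; rewrite heat_lawE//.
pose K := block_kernel r lam_ge0 mS L.
have mK : measurable_fun setT (fun x => K (X, x) E).
  exact: (measurableT_comp (measurable_kernel K E mE) (pair1_measurable X)).
have kE x : block_law r lam_ge0 mS x L X
    ((fun Z => (outside x L X `|` Z)%fset : config) @^-1` E) = K (X, x) E.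
  by rewrite /K block_kernelE.
transitivity (\int[uniform_law volume (measurable_thickening (centers r A) L)]_x K (X, x) E)%E.
  rewrite integral_uniform_law//; congr (_ / _)%E.
  by apply: eq_integral => x _; rewrite -kE; exact: resampleE.
by apply: eq_integral => x _; rewrite -kE.
Qed.

End heat_bath_identification.

(** * Temporal mixing *)

Section iteration.
Context {R : realType} {d : nat} (r lam : R) (r_gt0 : 0 < r) (lam_ge0 : 0 <= lam).
Local Notation row := 'rV[R]_d.
Local Notation config := (@config R d).
Implicit Types (A tau : set row) (f g : config -> R).

(** Since the operator acts on functions, the induction keeps [f] general and peels off the last
    step of the chain. *)
Lemma dynamics_mean A tau (mS : measurable (centers r A `\` tau)) L
    (mT := measurable_thickening (centers r A) L) dX (TX : measurableType dX)
    (PX : probability TX R) (X : nat -> TX -> config) t f :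
  (volume (centers r A `\` tau) < +oo)%E ->
  (0 < volume (thickening (centers r A) L))%E ->
  (volume (thickening (centers r A) L) < +oo)%E ->
  heat_bath_dynamics r lam L A tau PX X -> unit_function f ->
  mean PX (f \o X t) =
  mean PX (iter t (heat_operator r lam_ge0 mS L (uniform_law volume mT)) f \o X 0%N).
Proof.
move=> Sfin T0 Ty [mX XA step]; elim: t f => [//|t IH] f uf.
rewrite iterSr -IH; last exact: unit_heat_operator.
apply: mean_heat_step => // E mE.
(* With the whole space as past event, the Markov property reduces to the one-step law. *)
have pT : past X t setT by rewrite -setC0; apply: sigma_algebraC; exact: sigma_algebra0.
have := step t _ E pT mE; rewrite setTI => ->.
by apply: eq_integral => w _; apply: heat_bathE.
Qed.

Lemma lipschitz_oscillation A S (h : config -> R) c Z : region A -> (volume A < +oo)%E ->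
  volume (euclidean_ball (0 : row) r) = 1%E -> S `<=` centers r A -> 0 <= c ->
  point_lipschitz r S c h -> packed r S Z ->
  `|h Z - h (fset0 : {fset row})| <= c * fine (volume A).
Proof.
move=> [_ mA] Afin bv SA c0 lh pZ.
apply: le_trans (lipschitz_sub c0 lh (fsub0set _) pZ) _.
rewrite fsetD0 ler_wpM2l//; apply: (packed_card r_gt0 bv) => //.
exact: packedS SA pZ.
Qed.

End iteration.

Lemma unit_indic d (T : measurableType d) (R : realType) (E : set T) :
  measurable E -> unit_function (\1_E : T -> R).
Proof.
move=> mE; split; first exact: measurable_indic.
by move=> x; rewrite indicE; case: (x \in E); rewrite ?lexx ?ler01.
Qed.

Lemma mean_preimage d d' (T : measurableType d) (T' : measurableType d') (R : realType)
    (P : probability T R) (X : T -> T') (E : set T') : measurable_fun setT X ->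
  measurable E -> P (X @^-1` E) = (mean P (\1_E \o X))%:E.
Proof.
move=> mX mE.
have mXE : measurable (X @^-1` E) by rewrite -[A in measurable A]setTI; exact: mX.
rewrite (_ : \1_E \o X = \1_(X @^-1` E)); last first.
  by apply/funext => w /=; rewrite !indicE; congr (_%:R); apply/idP/idP; rewrite !inE.
by rewrite mean_indic// fineK// fin_num_measure.
Qed.

(** Rounding down loses less than one step, that is less than [1 / n <= 1] in the time scale of [s];
    the factor [expR q] pays for it. *)
Lemma exponential_rate (R : realType) (q n s : R) (t : nat) : 0 < q -> 1 <= n ->
  s * n < t.+1%:R -> expR (- (q / n)) ^+ t <= expR q * expR (- (q * s)).
Proof.
move=> q0 n1 st; have n0 : 0 < n by rewrite (lt_le_trans _ n1).
rewrite -expRM_natl -expRD ler_expR mulrN lerNl opprD opprK.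
rewrite -natr1 in st.
have : s - 1 <= t%:R / n.
  rewrite ler_pdivlMr// mulrBl mul1r.
  by rewrite lerBlDr (le_trans (ltW st))// lerD2l.
move=> h; rewrite mulrCA addrC.
have -> : q * s - q = q * (s - 1) by ring.
by apply: ler_wpM2l => //; exact: ltW.
Qed.

Lemma unit_dist (R : realDomainType) (x y : R) : 0 <= x -> x <= 1 -> 0 <= y -> y <= 1 ->
  `|x - y| <= 1.
Proof.
move=> x0 x1 y0 y1; rewrite ler_distl lerBlDr.
by rewrite (le_trans y1) ?lerDr//= (le_trans x1)// lerDr.
Qed.

Lemma dist_via (R : realDomainType) (x y a e : R) : `|x - a| <= e -> `|y - a| <= e ->
  `|x - y| <= 2 * e.
Proof.
move=> xa ya; rewrite (le_trans (ler_distD a _ _))// mulr_natl mulr2n lerD//.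
by rewrite distrC.
Qed.

Theorem theorem2p4 (R : realType) (d : nat) (hd : (2 <= d)%N)
  (r : R) (hr : 0 < r)
  (hvol : volume (euclidean_ball (0 : 'rV[R]_d) r) = 1%E)
  (lam : R) (hlam : 0 < lam) :
  strong_spatial_mixing d r lam ->
  exists L0 : R, 0 < L0 /\
    forall L : R, L0 <= L -> optimal_temporal_mixing d r lam L.
Proof.
move=> [alpha [beta [al0 be0 ssm]]].
have d0 : (0 < d)%N by apply: leq_trans hd.
have lam0 := ltW hlam.
have [L0 L00 hL0] := block_size_choice d0 hr al0 be0.
exists L0; split => // L L0L; have [K K0 small] := hL0 _ L0L.
have L_gt0 : 0 < L by rewrite (lt_le_trans L00).
pose b := (L / r) ^+ d; pose D := ((L + 3 * r) / r) ^+ d.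
have b0 : 0 < b by rewrite exprn_gt0// divr_gt0.
have D0 : 0 < D by rewrite exprn_gt0// divr_gt0// addr_gt0// mulr_gt0.
(* Since the volume of update centers is at most [n * D], each step gains at least [q / n]; so [q]
   is the rate per unit of [s]. *)
pose q := b / 2 / D; have q0 : 0 < q by rewrite divr_gt0// divr_gt0.
(* The 2 comes from comparing each chain with a common value, [expR q] from rounding [s * n]
   down. *)
exists (2 * expR q), q; split => //; first by rewrite mulr_gt0// expR_gt0.
move=> A rA [v Av] tau [mtau tauA] s s0 dX TX PX X dY TY PY Y hX hY.
pose n := fine (volume A); pose t := Num.truncn (s * n).
suff : (total_variation_dist (pushforward PX (X t)) (pushforward PY (Y t)) <=
    (2 * expR q * n * expR (- (q * s)))%:E)%E by [].
have [cA mA] := rA.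
have Afin : (volume A < +oo)%E by exact: (compact_volume_lty hr hvol).
have AE : volume A = n%:E by rewrite fineK// ge0_fin_numE.
(* The ball of volume 1 about the given center lies in [A]. *)
have n1 : 1 <= n.
  rewrite -lee_fin -AE -(_ : volume (euclidean_ball v r) = 1%E).
    apply: le_measure; rewrite ?inE//; first exact: measurable_eball.
    exact: centers_ball.
  by rewrite (volume_eball hr hvol)// divff ?gt_eqF// expr1n.
pose S := centers r A `\` tau.
have mS : measurable S by apply: measurableD => //; exact: measurable_centers.
have SC : S `<=` centers r A by exact: subDsetl.
have Sfin : (volume S < +oo)%E.
  apply: le_lt_trans Afin; apply: le_measure; rewrite ?inE//.
  by apply: subset_trans SC _; exact: centers_sub.
pose T := thickening (centers r A) L.
have mT : measurable T by exact: measurable_thickening.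
have T_le : (volume T <= (n * D)%:E)%E by exact: (thickening_volume_le hr hvol).
have T_ge : (b%:E <= volume T)%E.
  rewrite -(volume_eball hr hvol v L_gt0); apply: le_measure; rewrite ?inE//.
    exact: measurable_eball.
  exact: eball_sub_thickening.
have T_gt0 : (0 < volume T)%E by rewrite (lt_le_trans _ T_ge).
have T_lty : (volume T < +oo)%E by rewrite (le_lt_trans T_le)// ltry.
pose V := fine (volume T).
have VE : volume T = V%:E by rewrite fineK// ge0_fin_numE.
have V_le : V <= n * D by rewrite -lee_fin -VE.
have V_ge : b <= V by rewrite -lee_fin -VE.
have V0 : 0 < V by rewrite (lt_le_trans b0).
pose rate := @contraction_rate R d r A L.
have rateE : rate = 1 - b / 2 / V by [].
have rate_ge0 : 0 <= rate.
  rewrite rateE subr_ge0 ler_pdivrMr// mul1r (le_trans _ V_ge)//.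
  by rewrite ler_pdivrMr// ler_peMr ?ler1n// ltW.
have rate_le : rate <= expR (- (q / n)).
  apply: le_trans (expR_ge1Dx _); rewrite rateE lerD2l lerN2.
  have n0 : 0 < n by rewrite (lt_le_trans _ n1).
  rewrite /q -mulrA -invfM ler_wpM2l ?divr_ge0 ?(ltW b0)//.
  by rewrite lef_pV2 ?posrE ?mulr_gt0// mulrC.
pose H := heat_operator r lam0 mS L (uniform_law volume (measurable_thickening (centers r A) L)).
have iter_unit (f : @config R d -> R) k : unit_function f -> unit_function (iter k H f).
  by move=> uf; elim: k => [//|k IH]; rewrite iterS; exact: unit_heat_operator.
have iter_lip (f : @config R d -> R) k : unit_function f ->
    point_lipschitz r S (rate ^+ k) (iter k H f).
  move=> uf; elim: k => [|k IH].
    (* Any function with values in [0,1] starts with constant 1. *)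
    rewrite expr0 => Z w _ _ /=; have [_ f1] := uf.
    have /andP[x0 x1] := f1 (w |` Z)%fset; have /andP[y0 y1] := f1 (Z : {fset 'rV[R]_d}).
    exact: unit_dist.
  rewrite iterS exprS.
  apply: (@heat_operator_contracts R d r lam hr lam0 hvol alpha beta al0 be0 ssm A S mS rA SC
    Sfin L K L_gt0 K0 T_gt0 T_lty small) => //.
  - exact: iter_unit.
  - by rewrite exprn_ge0.
(* The reference value at the empty configuration is the same for both chains, whatever their
   initial laws. *)
have near dZ (TZ : measurableType dZ) (PZ : probability TZ R)
    (Z : nat -> TZ -> @config R d) (f : @config R d -> R) :
    unit_function f -> heat_bath_dynamics r lam L A tau PZ Z ->
    `|mean PZ (f \o Z t) - iter t H f (fset0 : {fset 'rV[R]_d})| <= rate ^+ t * n.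
  move=> uf hZ; rewrite (dynamics_mean lam0 mS t Sfin T_gt0 T_lty hZ uf).
  have [mI I1] := iter_unit f t uf; have [mZ ZA _] := hZ.
  apply: (@mean_near _ _ _ _ _ _ _ 1).
  - exact: (measurableT_comp mI (mZ 0%N)).
  - by move=> w; exact: I1.
  - by have /andP[] := I1 (fset0 : {fset 'rV[R]_d}).
  - by rewrite mulr_ge0 ?exprn_ge0// (le_trans _ n1).
  - move=> w; apply: (lipschitz_oscillation hr rA Afin hvol SC) => //.
    + by rewrite exprn_ge0.
    + exact: iter_lip.
    + exact: ZA.
have tv_bound : 2 * (rate ^+ t * n) <= 2 * expR q * n * expR (- (q * s)).
  have sn : 0 <= s * n by rewrite mulr_ge0 ?(ltW s0)// (le_trans _ n1).
  have := exponential_rate q0 n1 (andP (truncn_itv sn)).2.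
  move=> er; have rt : rate ^+ t <= expR (- (q / n)) ^+ t by rewrite lerXn2r ?nnegrE ?expR_ge0.
  have := le_trans rt er => h.
  rewrite (_ : 2 * expR q * n * _ = 2 * ((expR q * expR (- (q * s))) * n)); last by ring.
  by rewrite ler_wpM2l// ler_wpM2r// (le_trans _ n1).
apply: ge_ereal_sup => _ [E mE <-].
have [mXt _ _] := hX; have [mYt _ _] := hY.
rewrite /pushforward (mean_preimage PX (mXt t) mE) (mean_preimage PY (mYt t) mE).
rewrite -EFinB /= lee_fin; apply: le_trans tv_bound.
have uE := unit_indic R mE.
exact: dist_via (near _ _ _ _ _ uE hX) (near _ _ _ _ _ uE hY).
Qed.
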